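(* Let $\Gamma=\Gamma_p$ for some $1<p\leq 2$, and let $u$ be a (continuous) viscosity solution of $$\lambda(A^u)\in\partial\Gamma\quad\text{in}\ \mathbb{R}^2\setminus\{0\}.$$ Then $u$ is locally Lipschitz in $\mathbb{R}^2\setminus\{0\}$ and radially symmetric about the origin. Moreover, $u(x)$ is monotonically nonincreasing in $|x|$.
   Context: For $1\le p\le 2$, $\Gamma_p:=\{(\lambda_1,\lambda_2)\in\mathbb{R}^2:\lambda_2>(p-2)\lambda_1,\ \lambda_1>(p-2)\lambda_2\}$. For a $C^2$ function $u$ on an open subset of $\mathbb{R}^2$, $$A^u=-\frac{\nabla^2u}{e^u}+\frac{1}{2}\frac{du\otimes du}{e^u}-\frac{1}{4}\frac{|\nabla u|^2}{e^u}I,$$ and $\lambda(A^u)$ denotes the eigenvalues of the symmetric matrix $A^u$. Viscosity solutions: let $\Omega\subset\mathbb{R}^2$ be open. An upper semicontinuous $u:\Omega\to\mathbb{R}\cup\{-\infty\}$, $u\not\equiv-\infty$, is a viscosity subsolution of $\lambda(A^u)\in\partial\Gamma$ in $\Omega$ if for any $x_0\in\Omega$ and $\varphi\in C^2(\Omega)$ with $(u-\varphi)(x_0)=0$ and $u-\varphi\le 0$ near $x_0$, one has $\lambda(A^\varphi(x_0))\in\mathbb{R}^2\setminus\Gamma$. A lower semicontinuous $u:\Omega\to\mathbb{R}\cup\{+\infty\}$, $u\not\equiv+\infty$, is a viscosity supersolution if for any $x_0\in\Omega$ and $\varphi\in C^2(\Omega)$ with $(u-\varphi)(x_0)=0$ and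 $u-\varphi\ge 0$ near $x_0$, one has $\lambda(A^\varphi(x_0))\in\bar\Gamma$. A viscosity solution is a function that is both a viscosity subsolution and a viscosity supersolution. *)

(* Defs.v *)
From mathcomp Require Import all_boot all_order all_algebra.
From mathcomp Require Import all_classical all_reals all_analysis.

Set Implicit Arguments.
Unset Strict Implicit.
Unset Printing Implicit Defensive.

Import Order.TTheory GRing.Theory Num.Theory.
Import numFieldNormedType.Exports.

Local Open Scope classical_set_scope.
Local Open Scope ring_scope.

Section Defs.
Context {R : realType}.
Local Notation plane := 'rV[R]_2.

(* The library norm on 'rV is the sup norm; the Euclidean one is needed for
   |grad u| and for radial symmetry. *)
Definition enorm (x : plane) : R := Num.sqrt (\sum_i x ord0 i ^+ 2).

Definition punctured_plane : set plane := [set x | x != 0].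

Definition dirv (i : 'I_2) : plane := delta_mx ord0 i.

Definition C1_on (Omega : set plane) (f : plane -> R) : Prop :=
  forall x, Omega x -> {for x, continuous f} /\
    forall i, derivable f x (dirv i) /\ {for x, continuous ('D_(dirv i) f)}.

Definition C2_on (Omega : set plane) (f : plane -> R) : Prop :=
  C1_on Omega f /\ forall i, C1_on Omega ('D_(dirv i) f).

Definition gradient (f : plane -> R) (x : plane) : plane :=
  \row_i 'D_(dirv i) f x.

Definition hessian (f : plane -> R) (x : plane) : 'M[R]_2 :=
  \matrix_(i, j) 'D_(dirv i) ('D_(dirv j) f) x.

(* A^f = - e^-f Hess f + (1/2) e^-f df (x) df - (1/4) e^-f |grad f|^2 I. *)
Definition conf_hessian (f : plane -> R) (x : plane) : 'M[R]_2 :=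
  - ((expR (f x))^-1 *: hessian f x)
  + 2^-1 *: ((expR (f x))^-1 *: ((gradient f x)^T *m gradient f x))
  - (4^-1 * (enorm (gradient f x) ^+ 2 / expR (f x)))%:M.

(* The eigenvalues of A, counted with multiplicity, form a pair in S. The sets
   S of interest are symmetric, so the order of the pair does not matter. *)
Definition eigenvalues_in (A : 'M[R]_2) (S : set (R * R)) : Prop :=
  exists2 l : R * R,
    char_poly A = ('X - (l.1)%:P) * ('X - (l.2)%:P) & S l.

Definition Gamma (p : R) : set (R * R) :=
  [set l | (p - 2) * l.1 < l.2 /\ (p - 2) * l.2 < l.1].

Section viscosity.
Variables (G : set (R * R)) (Omega : set plane) (u : plane -> \bar R).
Local Open Scope ereal_scope.

Definition usc_on : Prop := forall x, Omega x ->
  forall a : R, u x < a%:E -> \forall y \near x, u y < a%:E.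

Definition lsc_on : Prop := forall x, Omega x ->
  forall a : R, a%:E < u x -> \forall y \near x, a%:E < u y.

(* Omega is meant to be open and u is only considered on Omega. *)
Definition viscosity_subsolution : Prop :=
  [/\ forall x, Omega x -> u x != +oo,
      exists2 x, Omega x & u x != -oo,
      usc_on &
      forall (x0 : plane) (phi : plane -> R), Omega x0 -> C2_on Omega phi ->
        u x0 = (phi x0)%:E -> (\forall x \near x0, u x <= (phi x)%:E) ->
        eigenvalues_in (conf_hessian phi x0) (~` G)].

Definition viscosity_supersolution : Prop :=
  [/\ forall x, Omega x -> u x != -oo,
      exists2 x, Omega x & u x != +oo,
      lsc_on &
      forall (x0 : plane) (phi : plane -> R), Omega x0 -> C2_on Omega phi ->
        u x0 = (phi x0)%:E -> (\forall x \near x0, (phi x)%:E <= u x) ->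
        eigenvalues_in (conf_hessian phi x0) (closure G)].

(* The equation is lambda(A^u) \in \partial G: a subsolution stays out of the
   open cone G, a supersolution stays in its closure. *)
Definition viscosity_solution : Prop :=
  viscosity_subsolution /\ viscosity_supersolution.

End viscosity.

(* [lipschitz] uses the sup norm, which only changes the constants. *)
Definition locally_lipschitz_on (Omega : set plane) (f : plane -> R) : Prop :=
  forall x, Omega x -> exists2 U, nbhs x U & [lipschitz f y | y in U].

End Defs.

(* Main.v *)
Require Import Defs.
From mathcomp Require Import all_boot all_order all_algebra.
From mathcomp Require Import all_classical all_reals all_analysis.
From mathcomp Require Import ring lra.

(** Put w = e^(-u/2), z = |y|^2 and b = (p-1)/2. The theorem holds because the
    solutions are explicit: w^b = A z^b + B with constants A, B >= 0
    ([conf_pow_classification]). Such a [u] is radial and nonincreasing, u + 4 ln |y|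
    is nondecreasing, and these two monotonicities give the local Lipschitz bound.

    The classification compares [u] with explicit smooth functions only, so that no
    comparison principle between viscosity solutions is used. A function
    f(|y - a|^2) has a tangential and a radial eigenvalue; along the profiles
    w^k = A |y - a|^(2k) + B their ratio is constant, and a profile with A, B > 0 is
    a solution for k = b, cannot touch a supersolution from below for 0 < k < b, and
    cannot touch a subsolution from above for k > b ([profile_super],
    [profile_sub]). Comparison on annuli ([super_comparison], [sub_comparison]) is
    then the elementary argument at an extremum.

    Behaviour at the puncture. With k < b a profile can have its pole at an
    arbitrary point x and the value u(x) there: since p > 1, a point is seen by the
    comparison. This gives a Harnack inequality for supersolutions alone
    ([harnack_ball]), which a chain of balls extends to circles about 0
    ([harnack_circle]). The circle minima of [u] are monotone
    ([super_inner_min]), hence converge, and the Harnack inequality upgrades this to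
    a limit of w^k at 0 ([conf_pow_limit]). Radial tests from below are also
    available for the Kelvin transform ([radial_super_kelvin]), so that w/z has a
    limit at infinity.

    Conclusion. If both limits are positive, they determine for each exponent k
    one profile centred at 0; it lies below [u] for k < b and above [u] for k > b
    ([conf_pow_le_interp], [interp_le_conf_pow]), and k tends to b. If one of the
    limits vanishes, the other bounds w, respectively w/z, from above, and the
    equality case of the Harnack inequality makes this quantity constant. *)

Set Implicit Arguments.
Unset Strict Implicit.
Unset Printing Implicit Defensive.
Import Order.TTheory GRing.Theory Num.Theory.
Import numFieldNormedType.Exports.
Local Open Scope classical_set_scope.
Local Open Scope ring_scope.

(** * Jets of explicit test functions *)

Section Jets.
Variable R : realType.
Local Notation plane := 'rV[R]_2.
Implicit Types (f g : plane -> R) (x : plane).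

Lemma is_derive_line f x v d :
  is_derive x v f d <-> is_derive (0 : R) 1 (fun h : R => f (h *: v + x)) d.
Proof.
have E : 'D_1 (fun h : R => f (h *: v + x)) 0 = 'D_v f x.
  rewrite /derive; set g1 := fun h => h^-1 *: _; set g2 := fun h => h^-1 *: _.
  suff -> : g1 = g2 by []; apply/funext => h; rewrite /g1 /g2 /=.
  by rewrite scale0r add0r addr0 [h *: 1]mulr1.
split=> -[fv fd]; split.
- exact: (derivable1P f x v).1.
- by rewrite E.
- exact: (derivable1P f x v).2.
- by rewrite -E.
Qed.

Lemma is_derive_coord x v i : is_derive x v (fun y : plane => y ord0 i) (v ord0 i).
Proof.
apply/is_derive_line.
rewrite (_ : (fun _ => _) = (fun h : R => h * v ord0 i + x ord0 i)); last first.
  by apply/funext => h; rewrite !mxE.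
have h1 := is_deriveM (is_derive_id (0 : R) 1) (is_derive_cst (v ord0 i) (0 : R) 1).
have h2 := is_deriveD h1 (is_derive_cst (x ord0 i) (0 : R) 1).
by apply: (is_derive_eq h2); rewrite /cst addr0 /GRing.scale /= mul0r add0r mulr1.
Qed.

Lemma is_derive_comp1 (k : R -> R) f x v d e :
  is_derive (f x) 1 k e -> is_derive x v f d ->
  is_derive x v (fun y => k (f y)) (e * d).
Proof.
move=> kf /is_derive_line fx; apply/is_derive_line.
by apply: is_derive1_comp => //; rewrite scale0r add0r.
Qed.

Lemma near_subset (P Q : plane -> Prop) x : (forall y, P y -> Q y) ->
  (\forall y \near x, P y) -> \forall y \near x, Q y.
Proof. by move=> PQ; exact: (@filterS _ (nbhs x)). Qed.

Lemma near_eq_continuous f g x : (\forall y \near x, f y = g y) ->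
  {for x, continuous f} -> {for x, continuous g}.
Proof.
move=> fg; rewrite /prop_for /continuous_at (nbhs_singleton fg) => cf.
by apply: cvg_trans cf; exact: (@near_eq_cvg _ _ (nbhs x)).
Qed.

(** The partial derivatives [D] and second partial derivatives [H] are carried
    along as functions: jets of sums, products and compositions are then computed
    formally, and the conformal Hessian of a test function is read off from them. *)
Definition has_jet f (D : 'I_2 -> plane -> R) (H : 'I_2 -> 'I_2 -> plane -> R) :=
  forall x, x != 0 -> [/\ {for x, continuous f},
    forall j, {for x, continuous (D j)} /\ is_derive x (dirv j) f (D j x) &
    forall i j, {for x, continuous (H i j)} /\
      is_derive x (dirv i) (D j) (H i j x)].

Lemma punctured_near x : x != 0 -> \forall y \near x, y != 0.
Proof.
rewrite -normr_gt0 => x0.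
near=> y; rewrite -normr_gt0; near: y.
exact: (cvgr_gt `|x| (@norm_continuous R plane x) 0 x0).
Unshelve. all: by end_near.
Qed.

(** The derivatives demanded by [C2_on] are iterated limits of [f] itself; they
    agree with the carried functions near every nonzero point, because the
    punctured plane is open, and derivatives are local. *)
Lemma C2_of_jet f D H : has_jet f D H -> C2_on (@punctured_plane R) f.
Proof.
move=> J.
have E j x : x != 0 -> 'D_(dirv j) f x = D j x.
  by move=> x0; have [_ /(_ j)[_ h] _] := J x x0; rewrite derive_val.
have nE j x : x != 0 -> \forall y \near x, D j y = 'D_(dirv j) f y.
  by move=> /punctured_near; apply: near_subset => y /E ->.
have E2 i j x : x != 0 -> 'D_(dirv i) ('D_(dirv j) f) x = H i j x.
  move=> x0; have [_ _ /(_ i j)[_ h]] := J x x0.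
  by rewrite -(near_eq_derive (dirv i) (nE j x x0)) derive_val.
split=> [x x0|j x x0].
  have [cf Df _] := J x x0; split=> // j; split; first by case: (Df j) => _ [].
  by apply: near_eq_continuous (nE j x x0) _; case: (Df j).
have [_ Df Hf] := J x x0; split; first by apply: near_eq_continuous (nE j x x0) _; case: (Df j).
move=> i; split.
  by apply: near_eq_derivable (nE j x x0) _; case: (Hf i j) => _ [].
apply: (near_eq_continuous _ (Hf i j).1); apply: near_subset (punctured_near x0) => y y0.
by rewrite E2.
Qed.

Lemma gradient_jet f D H x j : has_jet f D H -> x != 0 ->
  gradient f x ord0 j = D j x.
Proof.
by move=> J x0; rewrite mxE; have [_ /(_ j)[_ h] _] := J x x0; rewrite derive_val.
Qed.

Lemma hessian_jet f D H x i j : has_jet f D H -> x != 0 ->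
  hessian f x i j = H i j x.
Proof.
move=> J x0; rewrite mxE.
have nE : \forall y \near x, D j y = 'D_(dirv j) f y.
  apply: near_subset (punctured_near x0) => y y0.
  by have [_ /(_ j)[_ h] _] := J y y0; rewrite derive_val.
have [_ _ /(_ i j)[_ h]] := J x x0.
by rewrite -(near_eq_derive (dirv i) nE) derive_val.
Qed.

Lemma jet_cst c : has_jet (fun=> c) (fun _ _ => 0) (fun _ _ _ => 0).
Proof.
move=> x x0; split=> [|j|i j]; first exact: cst_continuous.
  by split; [exact: cst_continuous|exact: is_derive_cst].
by split; [exact: cst_continuous|exact: is_derive_cst].
Qed.

Lemma jet_coord k : has_jet (fun y : plane => y ord0 k)
  (fun j _ => (j == k)%:R) (fun _ _ _ => 0).
Proof.
move=> x x0; split=> [|j|i j]; first exact: coord_continuous.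
  split; first exact: cst_continuous.
  apply: (is_derive_eq (is_derive_coord x (dirv j) k)).
  by rewrite /dirv mxE eqxx eq_sym.
by split; [exact: cst_continuous|exact: is_derive_cst].
Qed.

Lemma jetD f D H g E K : has_jet f D H -> has_jet g E K ->
  has_jet (fun y => f y + g y) (fun j y => D j y + E j y)
    (fun i j y => H i j y + K i j y).
Proof.
move=> Jf Jg x x0; have [cf Df Hf] := Jf x x0; have [cg Dg Hg] := Jg x x0.
split=> [|j|i j]; first exact: continuousD.
- by have [? ?] := Df j; have [? ?] := Dg j; split;
    [exact: continuousD|exact: is_deriveD].
- by have [? ?] := Hf i j; have [? ?] := Hg i j; split;
    [exact: continuousD|exact: is_deriveD].
Qed.

Lemma is_derive_prod f g x v df dg : is_derive x v f df -> is_derive x v g dg ->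
  is_derive x v (fun y => f y * g y) (df * g x + f x * dg).
Proof.
move=> h1 h2; apply: (is_derive_eq (is_deriveM h1 h2)).
by rewrite /GRing.scale /=; ring.
Qed.

Lemma jetM f D H g E K : has_jet f D H -> has_jet g E K ->
  has_jet (fun y => f y * g y) (fun j y => D j y * g y + f y * E j y)
    (fun i j y => H i j y * g y + D j y * E i y + (D i y * E j y + f y * K i j y)).
Proof.
move=> Jf Jg x x0; have [cf Df Hf] := Jf x x0; have [cg Dg Hg] := Jg x x0.
split=> [|j|i j]; first exact: continuousM.
- have [? ?] := Df j; have [? ?] := Dg j; split; last exact: is_derive_prod.
  by apply: continuousD; apply: continuousM.
- have [? ?] := Df j; have [? ?] := Dg j; have [? ?] := Df i.
  have [? ?] := Dg i; have [? ?] := Hf i j; have [? ?] := Hg i j; split.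
    by apply: continuousD; apply: continuousD; apply: continuousM.
  by apply: is_deriveD; apply: is_derive_prod.
Qed.

Lemma jet_comp f D H (k k1 k2 : R -> R) : has_jet f D H ->
  (forall x, x != 0 -> [/\ is_derive (f x) 1 k (k1 (f x)),
     is_derive (f x) 1 k1 (k2 (f x)) & {for f x, continuous k2}]) ->
  has_jet (fun y => k (f y)) (fun j y => k1 (f y) * D j y)
    (fun i j y => k2 (f y) * D i y * D j y + k1 (f y) * H i j y).
Proof.
move=> Jf Jk x x0; have [cf Df Hf] := Jf x x0; have [dk dk1 ck2] := Jk x x0.
have dC (l : R -> R) d : is_derive (f x) 1 l d -> {for f x, continuous l}.
  by case=> dl _; exact/differentiable_continuous/derivable1_diffP.
have cc (l : R -> R) : {for f x, continuous l} -> {for x, continuous (fun y => l (f y))}.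
  by move=> cl; apply: continuous_comp.
have ck := cc _ (dC _ _ dk); have ck1 := cc _ (dC _ _ dk1); have {}ck2 := cc _ ck2.
split=> [//|j|i j].
- have [? ?] := Df j; split; last exact: is_derive_comp1.
  exact: continuousM.
- have [? ?] := Df j; have [? ?] := Df i; have [? ?] := Hf i j; split.
    apply: continuousD; last exact: continuousM.
    by apply: continuousM => //; apply: continuousM.
  by apply: is_derive_prod => //; exact: is_derive_comp1.
Qed.

Lemma jet_eq f D H f' D' H' : has_jet f D H ->
  (forall x, x != 0 -> f x = f' x) ->
  (forall j x, x != 0 -> D j x = D' j x) ->
  (forall i j x, x != 0 -> H i j x = H' i j x) ->
  has_jet f' D' H'.
Proof.
move=> J ff DD HH x x0; have [cf Df Hf] := J x x0.
have nE g h : (forall x, x != 0 -> g x = h x) -> \forall y \near x, g y = h y.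
  by move=> gh; apply: near_subset (punctured_near x0) => y /gh.
split=> [|j|i j]; first exact: near_eq_continuous (nE _ _ ff) cf.
- have [? ?] := Df j; split; first exact: near_eq_continuous (nE _ _ (DD j)) _.
  by rewrite -DD //; exact: near_eq_is_derive (nE _ _ ff) _.
- have [? ?] := Hf i j; split; first exact: near_eq_continuous (nE _ _ (HH i j)) _.
  by rewrite -HH //; exact: near_eq_is_derive (nE _ _ (DD j)) _.
Qed.

End Jets.

(** * Trace and determinant of the conformal Hessian *)

Section ConformalHessian.
Variable R : realType.
Local Notation plane := 'rV[R]_2.
Implicit Types (x y a : plane) (s : R).

Definition norm2 x : R := x ord0 0 ^+ 2 + x ord0 1 ^+ 2.

Lemma sum2E (V : nmodType) (F : 'I_2 -> V) : \sum_i F i = F 0 + F 1.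
Proof. by rewrite !big_ord_recl big_ord0 addr0; congr (_ + F _); exact: val_inj. Qed.

Lemma det2E (S : comPzRingType) (A : 'M[S]_2) :
  \det A = A 0 0 * A 1 1 - A 0 1 * A 1 0.
Proof.
rewrite (expand_det_row _ ord0) sum2E /cofactor !det_mx11 !mxE /=.
rewrite (_ : lift 0 0 = 1); last exact: val_inj.
rewrite (_ : lift 1 0 = 0); last exact: val_inj.
rewrite /bump /=. by ring.
Qed.

(** Trace and determinant determine the unordered pair of eigenvalues, and both
    cones are symmetric, so that they decide whether the tests succeed. *)
Lemma eigenvalues2 (A : 'M[R]_2) S : eigenvalues_in A S ->
  exists l : R * R, [/\ S l, l.1 + l.2 = \tr A & l.1 * l.2 = \det A].
Proof.
case=> l e Sl; exists l; split=> //.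
all: have {}e : char_poly A = 'X^2 - (l.1 + l.2) *: 'X + (l.1 * l.2)%:P
  by rewrite e -mul_polyC polyCD polyCM; ring.
- have := char_poly_trace A (ltn0Sn 1); rewrite e !coefE /= => h.
  by apply: oppr_inj; rewrite -h; ring.
- have := char_poly_det A; rewrite e !coefE /= => h.
  by rewrite sqrrN expr1n mul1r in h; rewrite -h; ring.
Qed.

Lemma enorm_sq x : enorm x ^+ 2 = norm2 x.
Proof.
rewrite /enorm sqr_sqrtr; first by rewrite sum2E.
by rewrite sum2E addr_ge0 // sqr_ge0.
Qed.

(** In dimension two the term with the identity matrix absorbs half of the
    gradient square, leaving only the difference of the squares of the two partial
    derivatives on the diagonal; the trace is minus the Laplacian, up to e^(-f). *)
Lemma conf_hessian_tr_det f D H x : has_jet f D H -> x != 0 ->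
  let e := (expR (f x))^-1 in
  \tr (conf_hessian f x) = - (e * (H 0 0 x + H 1 1 x)) /\
  \det (conf_hessian f x) = e ^+ 2 *
    ((H 0 0 x - (D 0 x ^+ 2 - D 1 x ^+ 2) / 4) *
     (H 1 1 x + (D 0 x ^+ 2 - D 1 x ^+ 2) / 4) -
     (H 0 1 x - D 0 x * D 1 x / 2) * (H 1 0 x - D 0 x * D 1 x / 2)).
Proof.
move=> J x0 e.
have g2 : enorm (gradient f x) ^+ 2 = D 0 x ^+ 2 + D 1 x ^+ 2.
  by rewrite enorm_sq /norm2 !(gradient_jet _ J x0).
have E i j : conf_hessian f x i j = - (e * H i j x) + 2^-1 * (e * (D i x * D j x))
    - (4^-1 * ((D 0 x ^+ 2 + D 1 x ^+ 2) * e)) *+ (i == j).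
  rewrite /conf_hessian g2 !mxE big_ord1 !mxE.
  have := gradient_jet i J x0; have := gradient_jet j J x0.
  by have := hessian_jet i j J x0; rewrite !mxE => -> -> ->.
rewrite /mxtrace sum2E det2E !E !eqxx /= !mulr1n !mulr0n.
by split; field.
Qed.

End ConformalHessian.

(** * Radial test functions and the Kelvin transform *)

Section RadialTests.
Variable R : realType.
Local Notation plane := 'rV[R]_2.
Implicit Types (x y a : plane) (s : R) (v : plane -> R).

Definition quadratic (f0 f1 f2 w : R) : R := f0 + f1 * w + f2 / 2 * w ^+ 2.

(** For f(|y - a|^2), the matrix A is, up to a positive factor, diagonal in
    polar coordinates about [a], with the tangential eigenvalue [eig_tan z f'] and
    the radial eigenvalue [eig_rad z f' f''], where z = |y - a|^2. *)
Definition eig_tan (z f1 : R) : R := - (2 * f1 + z * f1 ^+ 2).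
Definition eig_rad (z f1 f2 : R) : R := - (2 * f1 + 4 * z * f2 - z * f1 ^+ 2).

(** What the equation says when tested from below by quadratic polynomials of
    |y - a|^2, for all centres [a]. These tests suffice for the whole argument, and
    unlike general test functions they are smooth on the plane, centre included,
    and are carried by inversion to explicit functions. *)
Definition radial_super p v := forall a x f0 f1 f2, x != 0 -> v x = f0 ->
  (\forall y \near x, quadratic f0 f1 f2 (norm2 (y - a) - norm2 (x - a)) <= v y) ->
  let T := eig_tan (norm2 (x - a)) f1 in
  let Q := eig_rad (norm2 (x - a)) f1 f2 in
  0 <= Q + (2 - p) * T /\ 0 <= T + (2 - p) * Q.

Definition radial_sub p v := forall a x f0 f1 f2, x != 0 -> v x = f0 ->
  (\forall y \near x, v y <= quadratic f0 f1 f2 (norm2 (y - a) - norm2 (x - a))) ->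
  let T := eig_tan (norm2 (x - a)) f1 in
  let Q := eig_rad (norm2 (x - a)) f1 f2 in
  ~ (0 < Q + (2 - p) * T /\ 0 < T + (2 - p) * Q).

Definition kelvin y : plane := (norm2 y)^-1 *: y.
(** The transform of [u] under which the metric e^u |dx|^2 is pulled back by the
    inversion: it exchanges the behaviours at 0 and at infinity. *)
Definition kelvin_transform v y : R := v (kelvin y) - 2 * ln (norm2 y).

Lemma norm2_ge0 x : 0 <= norm2 x.
Proof. by rewrite /norm2 addr_ge0 ?sqr_ge0. Qed.

Lemma norm2_gt0 x : (0 < norm2 x) = (x != 0).
Proof.
rewrite lt_neqAle norm2_ge0 andbT eq_sym /norm2 paddr_eq0 ?sqr_ge0 // !sqrf_eq0.
congr (~~ _); apply/andP/eqP => [[/eqP x0 /eqP x1]|->]; last by rewrite !mxE.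
apply/rowP => i; rewrite mxE -x0; case: i => -[|[|//]] h.
  by congr (x _ _); exact: val_inj.
by rewrite x0 -x1; congr (x _ _); exact: val_inj.
Qed.

Lemma norm2Z c x : norm2 (c *: x) = c ^+ 2 * norm2 x.
Proof. by rewrite /norm2 !mxE; ring. Qed.

Lemma norm2_kelvin x : x != 0 -> norm2 (kelvin x) = (norm2 x)^-1.
Proof. by rewrite -norm2_gt0 => x0; rewrite norm2Z; field; rewrite gt_eqF. Qed.

Lemma kelvin_neq0 x : x != 0 -> kelvin x != 0.
Proof. by move=> x0; rewrite -norm2_gt0 norm2_kelvin // invr_gt0 norm2_gt0. Qed.

Lemma kelvinK x : x != 0 -> kelvin (kelvin x) = x.
Proof.
move=> x0; rewrite {1}/kelvin norm2_kelvin // invrK scalerA divff ?scale1r //.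
by rewrite gt_eqF // norm2_gt0.
Qed.

Lemma jet_norm2B a : has_jet (fun y => norm2 (y - a))
  (fun j y => 2 * (y ord0 j - a ord0 j)) (fun i j _ => 2 * (i == j)%:R).
Proof.
have J k := jetD (jet_coord k) (@jet_cst R (- a ord0 k)).
have J2 := jetD (jetM (J 0) (J 0)) (jetM (J 1) (J 1)).
apply: jet_eq J2 _ _ _ => [y _|j y _|i j y _]; rewrite /norm2 ?mxE /=; first by ring.
  case: j => -[|[|//]] h.
    rewrite (_ : Ordinal h = 0) /=; [by ring|exact: val_inj].
  rewrite (_ : Ordinal h = 1) /=; [by ring|exact: val_inj].
case: i => -[|[|//]] hi; case: j => -[|[|//]] hj /=; rewrite -?val_eqE /=; ring.
Qed.

Lemma jet_norm2 : has_jet (@norm2 R)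
  (fun j y => 2 * y ord0 j) (fun i j _ => 2 * (i == j)%:R).
Proof.
by apply: jet_eq (jet_norm2B 0) _ _ _ => [y _|j y _|//]; rewrite ?subr0 // mxE subr0.
Qed.

Lemma is_derive_quadratic (f0 f1 f2 z0 z : R) :
  is_derive z 1 (fun w => quadratic f0 f1 f2 (w - z0)) (f1 + f2 * (z - z0)).
Proof.
have h : is_derive z 1 (fun w : R => w - z0) 1.
  by have := is_deriveD (is_derive_id z 1) (is_derive_cst (- z0) z 1); rewrite addr0.
have c (k : R) := is_derive_cst k z (1 : R).
have h2 := is_deriveM (c (f2 / 2)) (is_deriveM h h).
have h1 := is_deriveD (is_deriveD (c f0) (is_deriveM (c f1) h)) h2.
rewrite (_ : (fun _ => _) = cst f0 + cst f1 * (fun w => w - z0) +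
   cst (f2 / 2) * ((fun w => w - z0) * (fun w => w - z0))); last first.
  by apply/funext => w; rewrite /quadratic expr2.
by apply: (is_derive_eq h1); rewrite !scaler0 /cst /GRing.scale /=; field.
Qed.

Lemma is_derive_dquadratic (f1 f2 z0 z : R) :
  is_derive z 1 (fun w => f1 + f2 * (w - z0)) f2.
Proof.
have := is_derive_quadratic f1 f2 0 z0 z; rewrite mul0r addr0.
by rewrite (_ : (fun _ => _) = (fun w => f1 + f2 * (w - z0))) //;
  apply/funext => w; rewrite /quadratic !mul0r addr0.
Qed.

Lemma jet_quadratic f D H f0 f1 f2 z0 : @has_jet R f D H ->
  has_jet (fun y => quadratic f0 f1 f2 (f y - z0))
    (fun j y => (f1 + f2 * (f y - z0)) * D j y)
    (fun i j y => f2 * D i y * D j y + (f1 + f2 * (f y - z0)) * H i j y).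
Proof.
move=> J; apply: (jet_comp (k := fun w => quadratic f0 f1 f2 (w - z0))
  (k1 := fun w => f1 + f2 * (w - z0)) (k2 := fun=> f2) J) => x x0; split.
- exact: is_derive_quadratic.
- exact: is_derive_dquadratic.
- exact: cst_continuous.
Qed.

Lemma jet_ln_norm2 : has_jet (fun y => ln (@norm2 R y))
  (fun j y => (norm2 y)^-1 * (2 * y ord0 j))
  (fun i j y => - (norm2 y) ^- 2 * (2 * y ord0 i) * (2 * y ord0 j)
     + (norm2 y)^-1 * (2 * (i == j)%:R)).
Proof.
apply: (jet_comp (k := @ln R) (k1 := fun z => z^-1) (k2 := fun z => - z ^- 2) jet_norm2).
move=> x; rewrite -norm2_gt0 => x0; have xn : norm2 x != 0 by rewrite gt_eqF.
split; first exact: is_derive1_ln.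
- have := is_deriveV (f := id) xn (is_derive_id (norm2 x) (1 : R)).
  by rewrite [_ *: _]mulr1.
- apply: (@continuousN _ _ _ (fun z : R => z ^- 2)).
  apply: (@continuousV _ _ (fun z : R => z ^+ 2)); first by rewrite sqrf_eq0.
  exact: exprn_continuous.
Qed.

Lemma jet_norm2V : has_jet (fun y => (@norm2 R y)^-1)
  (fun j y => - 2 * y ord0 j / norm2 y ^+ 2)
  (fun i j y => 8 * y ord0 i * y ord0 j / norm2 y ^+ 3 -
     2 * (i == j)%:R / norm2 y ^+ 2).
Proof.
have J := jet_comp (k := fun z => z^-1) (k1 := fun z => - z ^- 2)
  (k2 := fun z => 2 * z ^- 3) jet_norm2.
have : forall x : plane, x != 0 -> [/\ is_derive (norm2 x) (1 : R) (fun z : R => z^-1) (- norm2 x ^- 2),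
   is_derive (norm2 x) (1 : R) (fun z : R => - z ^- 2) (2 * norm2 x ^- 3) &
   {for norm2 x, continuous (fun z : R => 2 * z ^- 3)}].
  move=> x; rewrite -norm2_gt0 => x0; have xn : norm2 x != 0 by rewrite gt_eqF.
  have x2 : norm2 x ^+ 2 != 0 by rewrite sqrf_eq0.
  split.
  - have := is_deriveV (f := id) xn (is_derive_id (norm2 x) (1 : R)).
    by rewrite [_ *: _]mulr1.
  - have h := is_deriveX 2 (is_derive_id (norm2 x) (1 : R)).
    have h2 := is_deriveN (is_deriveV (f := fun z : R => z ^+ 2) x2 h).
    by apply: (is_derive_eq h2); rewrite /GRing.scale /= expr1; field.
  - apply: (@continuousM _ _ (fun=> 2) (fun z : R => z ^- 3)).
      exact: cst_continuous.
    apply: (@continuousV _ _ (fun z : R => z ^+ 3)); first by rewrite expf_neq0.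
    exact: exprn_continuous.
move=> /J {}J; apply: jet_eq J _ _ _ => [//|j y|i j y]; rewrite -norm2_gt0 => y0; field;
  by rewrite gt_eqF.
Qed.

(** Away from 0, |kelvin y - a|^2 = (1 - 2 a.y)/|y|^2 + |a|^2, a product of
    functions whose jets are known. *)
Lemma jet_norm2_kelvinB a :
 let L y : R := 1 - 2 * (a ord0 0 * y ord0 0 + a ord0 1 * y ord0 1) in
 has_jet (fun y => norm2 (kelvin y - a))
  (fun j y => - 2 * a ord0 j / norm2 y - 2 * y ord0 j * L y / norm2 y ^+ 2)
  (fun i j y => (4 * a ord0 i * y ord0 j + 4 * a ord0 j * y ord0 i -
      2 * (i == j)%:R * L y) / norm2 y ^+ 2
    + 8 * y ord0 i * y ord0 j * L y / norm2 y ^+ 3).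
Proof.
move=> L; have c (k : R) := jet_cst k.
have J1 := jetD (c 1) (jetM (c (- 2)) (jetD (jetM (c (a ord0 0)) (jet_coord 0))
  (jetM (c (a ord0 1)) (jet_coord 1)))).
have J := jetD (jetM J1 jet_norm2V) (c (norm2 a)).
have D01 (j : 'I_2) : a ord0 0 * (j == 0)%:R + a ord0 1 * (j == 1)%:R = a ord0 j.
  case: j => -[|[|//]] h.
    by rewrite (_ : Ordinal h = 0) /= ?mulr1 ?mulr0 ?addr0 //; exact: val_inj.
  by rewrite (_ : Ordinal h = 1) /= ?mulr1 ?mulr0 ?add0r //; exact: val_inj.
apply: jet_eq J _ _ _ => [y|j y|i j y]; rewrite -norm2_gt0 => y0.
- have : norm2 y != 0 by rewrite gt_eqF.
  by rewrite /kelvin /norm2 !mxE => ny; field.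
- by rewrite -(D01 j) /L; field; rewrite gt_eqF.
- by rewrite -(D01 j) -(D01 i) /L; field; rewrite gt_eqF.
Qed.
End RadialTests.

Section ConeConditions.
Variable R : realType.
Local Notation plane := 'rV[R]_2.
Implicit Types (x y a : plane) (p : R) (u : plane -> R).

(** The right-hand set is closed and contains the cone. *)
Lemma closure_Gamma p (l : R * R) : closure (Gamma p) l ->
  0 <= l.2 + (2 - p) * l.1 /\ 0 <= l.1 + (2 - p) * l.2.
Proof.
pose C := [set m : R * R | 0 <= m.2 + (2 - p) * m.1] `&`
  [set m : R * R | 0 <= m.1 + (2 - p) * m.2].
have clC : closed C.
  have c1 : continuous (fun m : R * R => m.2 + (2 - p) * m.1).
    by move=> m; apply: cvgD; [exact: cvg_snd|apply: cvgM; [exact: cvg_cst|exact: cvg_fst]].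
  have c2 : continuous (fun m : R * R => m.1 + (2 - p) * m.2).
    by move=> m; apply: cvgD; [exact: cvg_fst|apply: cvgM; [exact: cvg_cst|exact: cvg_snd]].
  apply: closedI.
    exact: (closed_comp (fun m _ => c1 m) (@closed_ge R 0)).
  exact: (closed_comp (fun m _ => c2 m) (@closed_ge R 0)).
have GC : Gamma p `<=` C.
  by move=> [m1 m2] [/= h1 h2]; split; rewrite /=; lra.
by move=> /(closureS GC); rewrite -(closure_id C).1.
Qed.

Lemma root_pair (l1 l2 a b : R) : l1 + l2 = a + b -> l1 * l2 = a * b ->
  (l1 = a /\ l2 = b) \/ (l1 = b /\ l2 = a).
Proof.
move=> hs hp; have l2E : l2 = a + b - l1 by rewrite -hs; ring.
have /eqP : (l1 - a) * (l1 - b) = 0.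
  rewrite (_ : _ * _ = l1 ^+ 2 - (a + b) * l1 + a * b); last by ring.
  by rewrite -hs -hp; ring.
rewrite mulf_eq0 !subr_eq0 l2E => /orP[] /eqP ->; [left|right]; split=> //; ring.
Qed.

(** The tests produce a trace and a determinant; the eigenvalues can be taken to
    be [E * T] and [E * Q] because a pair is determined by its sum and product. *)
Lemma cone_super p (A : 'M[R]_2) E T Q : eigenvalues_in A (closure (Gamma p)) ->
  0 < E -> \tr A = E * (T + Q) -> \det A = E ^+ 2 * (T * Q) ->
  0 <= Q + (2 - p) * T /\ 0 <= T + (2 - p) * Q.
Proof.
move=> /eigenvalues2[[l1 l2] /= [/closure_Gamma /= [h1 h2] <- <-]] E0 tE dE.
have : (l1 = E * T /\ l2 = E * Q) \/ (l1 = E * Q /\ l2 = E * T).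
  by apply: root_pair; rewrite ?tE ?dE; ring.
have e1 (r t : R) : E * (r + (2 - p) * t) = E * r + (2 - p) * (E * t) by ring.
by rewrite -(pmulr_rge0 (Q + _) E0) -(pmulr_rge0 (T + _) E0) !e1 => -[] [<- <-].
Qed.

Lemma cone_sub p (A : 'M[R]_2) E T Q : eigenvalues_in A (~` (Gamma p)) ->
  0 < E -> \tr A = E * (T + Q) -> \det A = E ^+ 2 * (T * Q) ->
  ~ (0 < Q + (2 - p) * T /\ 0 < T + (2 - p) * Q).
Proof.
move=> /eigenvalues2[[l1 l2] /= [h <- <-]] E0 tE dE.
have : (l1 = E * T /\ l2 = E * Q) \/ (l1 = E * Q /\ l2 = E * T).
  by apply: root_pair; rewrite ?tE ?dE; ring.
rewrite -(pmulr_rgt0 (Q + _) E0) -(pmulr_rgt0 (T + _) E0) => l12 [h1 h2]; apply: h.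
have e1 (r t : R) : (p - 2) * (E * r) < E * t = (0 < E * (t + (2 - p) * r)).
  by rewrite -subr_gt0; congr (_ < _); ring.
by case: l12 => -[-> ->]; split; rewrite /= e1.
Qed.

(** Trace and determinant of the diagonal form described at [eig_tan]. *)
Lemma conf_hessian_radial a x f0 f1 f2 : x != 0 ->
  let z0 := norm2 (x - a) in
  let phi y := quadratic f0 f1 f2 (norm2 (y - a) - z0) in
  let E := (expR (phi x))^-1 in
  let T := eig_tan z0 f1 in let Q := eig_rad z0 f1 f2 in
  [/\ C2_on (@punctured_plane R) phi, \tr (conf_hessian phi x) = E * (T + Q) &
    \det (conf_hessian phi x) = E ^+ 2 * (T * Q)].
Proof.
move=> x0 z0 phi E T Q.
have J := jet_quadratic f0 f1 f2 z0 (jet_norm2B a).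
have [] := conf_hessian_tr_det J x0; rewrite -/phi -/E => -> ->.
split; first exact: C2_of_jet J.
  clearbody E; rewrite /T /Q /eig_tan /eig_rad -/z0 subrr /= /z0 /norm2 !mxE.
  by field.
clearbody E; rewrite /T /Q /eig_tan /eig_rad -/z0 subrr /= /z0 /norm2 !mxE.
by field.
Qed.

(** Conformal covariance of A, verified by computation: a radial function of
    the inverted variable, corrected by the conformal factor of the inversion, has
    the eigenvalues of the radial function, up to a positive factor. *)
Lemma conf_hessian_kelvin a x f0 f1 f2 : x != 0 ->
  let z0 := norm2 (kelvin x - a) in
  let phi y := quadratic f0 f1 f2 (norm2 (kelvin y - a) - z0) - 2 * ln (norm2 y) in
  let E := (expR (phi x))^-1 / norm2 x ^+ 2 in
  let T := eig_tan z0 f1 in let Q := eig_rad z0 f1 f2 in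
  [/\ C2_on (@punctured_plane R) phi, \tr (conf_hessian phi x) = E * (T + Q) &
    \det (conf_hessian phi x) = E ^+ 2 * (T * Q)].
Proof.
move=> x0 z0 phi E T Q.
have J0 := jetD (jet_quadratic f0 f1 f2 z0 (jet_norm2_kelvinB a))
  (jetM (@jet_cst R (- 2)) (@jet_ln_norm2 R)).
have phiE y : y != 0 -> quadratic f0 f1 f2 (norm2 (kelvin y - a) - z0) +
  - 2 * ln (norm2 y) = phi y by rewrite /phi mulNr.
have J := jet_eq J0 phiE (fun _ _ _ => erefl) (fun _ _ _ _ => erefl).
have [] := conf_hessian_tr_det J x0; rewrite -/phi => -> ->.
have n0 : norm2 x != 0 by rewrite gt_eqF // norm2_gt0.
split; first exact: C2_of_jet J.
  rewrite /T /Q /eig_tan /eig_rad -/z0 subrr /= /E /z0 /kelvin.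
  by move: n0; rewrite /norm2 !mxE => n0; field; rewrite n0 gt_eqF // expR_gt0.
rewrite /T /Q /eig_tan /eig_rad -/z0 subrr /= /E /z0 /kelvin.
by move: n0; rewrite /norm2 !mxE => n0; field; rewrite n0 gt_eqF // expR_gt0.
Qed.
End ConeConditions.

Section FromViscosity.
Variable R : realType.
Local Notation plane := 'rV[R]_2.
Implicit Types (x y a : plane) (p : R) (u : plane -> R).

Lemma radial_super_viscosity p u :
  viscosity_supersolution (Gamma p) (@punctured_plane R) (fun x => (u x)%:E) ->
  radial_super p u.
Proof.
move=> [_ _ _ V] a x f0 f1 f2 x0 ux nx T Q.
have [C2 trE detE] := conf_hessian_radial a f0 f1 f2 x0.
set phi := (fun y => quadratic _ _ _ _) in C2 trE detE.
have phix : phi x = f0 by rewrite /phi subrr /quadratic expr0n /= !mulr0 !addr0.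
apply: (cone_super (V x phi x0 C2 _ _) _ trE detE).
- by rewrite phix ux.
- by apply: near_subset nx => y; rewrite lee_fin.
- by rewrite invr_gt0 expR_gt0.
Qed.

Lemma radial_sub_viscosity p u :
  viscosity_subsolution (Gamma p) (@punctured_plane R) (fun x => (u x)%:E) ->
  radial_sub p u.
Proof.
move=> [_ _ _ V] a x f0 f1 f2 x0 ux nx T Q.
have [C2 trE detE] := conf_hessian_radial a f0 f1 f2 x0.
set phi := (fun y => quadratic _ _ _ _) in C2 trE detE.
have phix : phi x = f0 by rewrite /phi subrr /quadratic expr0n /= !mulr0 !addr0.
apply: (cone_sub (V x phi x0 C2 _ _) _ trE detE).
- by rewrite phix ux.
- by apply: near_subset nx => y; rewrite lee_fin.
- by rewrite invr_gt0 expR_gt0.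
Qed.

Lemma norm2_continuous x : {for x, continuous (@norm2 R)}.
Proof.
have c i : {for x, continuous (fun y : plane => y ord0 i)}.
  exact: coord_continuous.
have c2 i : {for x, continuous (fun y : plane => y ord0 i ^+ 2)}.
  exact: continuousM (c i) (c i).
exact: continuousD (c2 0) (c2 1).
Qed.

Lemma kelvin_continuous x : x != 0 -> {for x, continuous (@kelvin R)}.
Proof.
move=> x0; have h1 : {for x, continuous (fun y => (@norm2 R y)^-1)}.
  by apply: continuousV; [rewrite gt_eqF // norm2_gt0|exact: norm2_continuous].
have h2 : {for x, continuous (@id plane)} by exact: cvg_id.
exact: (continuousZ h1 h2).
Qed.

Lemma kelvin_transformE u x : x != 0 ->
  kelvin_transform u (kelvin x) = u x + 2 * ln (norm2 x).
Proof.
move=> x0; rewrite /kelvin_transform kelvinK // norm2_kelvin // lnV ?posrE ?norm2_gt0 //.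
by rewrite mulrN opprK.
Qed.

Lemma kelvin_transform_continuous u :
  (forall x, x != 0 -> {for x, continuous u}) ->
  forall x, x != 0 -> {for x, continuous (kelvin_transform u)}.
Proof.
move=> cu x x0; apply: continuousB.
  apply: continuous_comp; first exact: kelvin_continuous.
  by apply: cu; exact: kelvin_neq0.
apply: continuousM; first exact: cst_continuous.
apply: continuous_comp; first exact: norm2_continuous.
by apply: continuous_ln; rewrite norm2_gt0.
Qed.

(** A quadratic test of the Kelvin transform at [x] pulls back to a test of [u] at
    [kelvin x], whose conformal Hessian is given by [conf_hessian_kelvin]. *)
Lemma radial_super_kelvin p u :
  viscosity_supersolution (Gamma p) (@punctured_plane R) (fun x => (u x)%:E) ->
  radial_super p (kelvin_transform u).
Proof.
move=> [_ _ _ V] a x f0 f1 f2 x0 ux nx T Q.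
have k0 := kelvin_neq0 x0.
have [C2 trE detE] := conf_hessian_kelvin a f0 f1 f2 k0.
move: C2 trE detE; rewrite kelvinK // -/T -/Q.
set phi := (fun y => quadratic _ _ _ _ - _) => C2 trE detE.
have phix : phi (kelvin x) = u (kelvin x).
  rewrite /phi kelvinK // subrr /quadratic expr0n /= !mulr0 !addr0 -ux.
  by have := kelvin_transformE u k0; rewrite kelvinK // => ->; rewrite addrK.
apply: (cone_super (V (kelvin x) phi k0 C2 _ _) _ trE detE).
- by rewrite phix.
- have := kelvin_continuous k0; rewrite /prop_for /continuous_at kelvinK // => /(_ _ nx).
  move=> /= n1; have n2 := punctured_near k0.
  near=> y; rewrite lee_fin /phi.
  have y0 : y != 0 by near: y.
  rewrite lerBlDr -kelvin_transformE //.
  by near: y.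
- by rewrite divr_gt0 ?invr_gt0 ?expR_gt0 // exprn_gt0 // norm2_gt0.
Unshelve. all: by end_near.
Qed.

End FromViscosity.

(** * Tests by twice differentiable radial functions *)

Section Taylor.
Variable R : realType.
Local Notation plane := 'rV[R]_2.
Implicit Types (x y a : plane) (p : R) (v : plane -> R).

(** The difference of the two sides vanishes at [z0] and its derivative has the
    sign of z - z0 near [z0], by differentiability of [f'] at [z0] and the margin
    [d]; the mean value theorem concludes. *)
Lemma taylor2_le (f f' : R -> R) (z0 f2 d : R) : 0 < d ->
  (\forall z \near z0, is_derive z (1 : R) f (f' z)) -> is_derive z0 (1 : R) f' f2 ->
  \forall z \near z0, quadratic (f z0) (f' z0) (f2 - d) (z - z0) <= f z.
Proof.
move=> d0 nf /is_derive1_caratheodory[g [gE gc g0]].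
have ng : \forall z \near z0, f2 - d < g z.
  by apply: (cvgr_gt (g z0) gc); rewrite g0 ltrBlDr ltrDl.
have /nbhs_ballP[e /= e0 he] : \forall z \near z0,
    is_derive z (1 : R) f (f' z) /\ f2 - d < g z.
  by near=> z; split; near: z.
have {}he z : `|z - z0| < e -> is_derive z (1 : R) f (f' z) /\ f2 - d < g z.
  by move=> ze; apply: he; rewrite -ball_normE /= distrC.
pose q z := quadratic (f z0) (f' z0) (f2 - d) (z - z0).
pose w z := f z - q z.
pose w' z := f' z - (f' z0 + (f2 - d) * (z - z0)).
have dw z : `|z - z0| < e -> is_derive z (1 : R) w (w' z).
  move=> ze; have [fz _] := he z ze.
  exact: (is_deriveB fz (is_derive_quadratic _ _ _ _ _)).
have w'E z : w' z = (g z - (f2 - d)) * (z - z0).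
  by rewrite /w' opprD addrA gE; ring.
have w0 : w z0 = 0 by rewrite /w /q subrr /quadratic expr0n /= !mulr0 !addr0 subrr.
have mvt lo hi : lo < hi -> (forall z, lo <= z <= hi -> `|z - z0| < e) ->
    exists2 c, lo < c < hi & w hi - w lo = w' c * (hi - lo).
  move=> lohi hle; have [||c] := @MVT R w w' lo hi lohi.
  - by move=> z; rewrite in_itv /= => /andP[h1 h2]; apply: dw; apply: hle; rewrite !ltW.
  - apply: derivable_within_continuous => z; rewrite in_itv /= => /hle /dw [] //.
  - by rewrite in_itv /= => hc e1; exists c.
apply/nbhs_ballP; exists e => //= z; rewrite -ball_normE /= distrC => ze.
suff : 0 <= w z by rewrite /w subr_ge0.
have [zz0|zz0|->] := ltgtP z z0; last by rewrite w0.
- have [|c /andP[c1 c2] E] := mvt z z0 zz0.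
    move=> t /andP[t1 t2]; apply: le_lt_trans ze; rewrite !(distrC _ z0).
    by rewrite !ger0_norm ?subr_ge0 ?lerB // ltW.
  have [|_ gc1] := he c; first by
    apply: le_lt_trans ze; rewrite !(distrC _ z0) !ger0_norm ?subr_ge0 ?lerB // ltW.
  move: E; rewrite w0 w'E; have h1 : 0 < g c - (f2 - d) by lra.
  have : 0 <= (g c - (f2 - d)) * (z0 - c) * (z0 - z).
    by rewrite !mulr_ge0 // ?subr_ge0 ltW.
  by lra.
- have [|c /andP[c1 c2] E] := mvt z0 z zz0.
    move=> t /andP[t1 t2]; apply: le_lt_trans ze.
    by rewrite !ger0_norm ?subr_ge0 ?lerB // ltW.
  have [|_ gc1] := he c; first by
    apply: le_lt_trans ze; rewrite !ger0_norm ?subr_ge0 ?lerB // ltW.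
  move: E; rewrite w0 subr0 w'E => ->.
  by rewrite !mulr_ge0 // ?subr_ge0 ltW.
Unshelve. all: by end_near.
Qed.

Lemma taylor2_ge (f f' : R -> R) (z0 f2 d : R) : 0 < d ->
  (\forall z \near z0, is_derive z (1 : R) f (f' z)) -> is_derive z0 (1 : R) f' f2 ->
  \forall z \near z0, f z <= quadratic (f z0) (f' z0) (f2 + d) (z - z0).
Proof.
move=> d0 nf df'.
have h1 : \forall z \near z0, is_derive z (1 : R) (fun z => - f z) (- f' z).
  by apply: filterS nf => z fz; exact: is_deriveN fz.
have h2 : is_derive z0 (1 : R) (fun z => - f' z) (- f2) by exact: is_deriveN df'.
by apply: filterS (taylor2_le d0 h1 h2) => z; rewrite /quadratic; lra.
Qed.

Lemma ge0_of_perturb (r b : R) : (forall d, 0 < d -> 0 <= r + b * d) -> 0 <= r.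
Proof.
move=> h; rewrite leNgt; apply/negP => r0.
have b0 : 0 < `|b| + 1 by rewrite ltr_wpDl.
have d0 : 0 < - r / 2 / (`|b| + 1) by rewrite !divr_gt0 // oppr_gt0.
have := h _ d0.
have : b * (- r / 2 / (`|b| + 1)) <= - r / 2.
  rewrite mulrA ler_pdivrMr // mulrC ler_pM2l ?divr_gt0 ?oppr_gt0 //.
  by have := ler_norm b; lra.
lra.
Qed.

(** Replacing [f] by its second order Taylor polynomial with f'' lowered by [d]
    keeps it below [v]; the conditions are closed, so [d] may tend to 0. *)
Lemma radial_super_test p v a x (f f' : R -> R) f2 : radial_super p v -> x != 0 ->
  let z := norm2 (x - a) in
  (\forall t \near z, is_derive t (1 : R) f (f' t)) -> is_derive z (1 : R) f' f2 ->
  v x = f z -> (\forall y \near x, f (norm2 (y - a)) <= v y) ->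
  let T := eig_tan z (f' z) in let Q := eig_rad z (f' z) f2 in
  0 <= Q + (2 - p) * T /\ 0 <= T + (2 - p) * Q.
Proof.
move=> V x0 z nf df' vx nx T Q.
have nz d : 0 < d -> \forall y \near x,
    quadratic (f z) (f' z) (f2 - d) (norm2 (y - a) - z) <= v y.
  move=> d0; have := taylor2_le d0 nf df'.
  have cz : {for x, continuous (fun y => norm2 (y - a))}.
    apply: continuous_comp; last exact: norm2_continuous.
    by apply: continuousB; [exact: cvg_id|exact: cst_continuous].
  move=> /cz /= h; near=> y; apply: le_trans (_ : f (norm2 (y - a)) <= _); near: y => //.
have P d (d0 : 0 < d) := V a x (f z) (f' z) (f2 - d) x0 vx (nz d d0).
by split; [apply: (@ge0_of_perturb _ (4 * z))|apply: (@ge0_of_perturb _ ((2 - p) * (4 * z)))];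
  move=> d d0; have [] := P d d0; rewrite -/z /T /Q /eig_tan /eig_rad; lra.
Unshelve. all: by end_near.
Qed.

Lemma norm2B_continuous a x : {for x, continuous (fun y => norm2 (y - a))}.
Proof.
apply: continuous_comp; last exact: norm2_continuous.
by apply: continuousB; [exact: cvg_id|exact: cst_continuous].
Qed.

Lemma gt0_perturb (r b : R) : 0 < r -> exists2 d, 0 < d &
  forall e, 0 < e -> e <= d -> 0 < r + b * e.
Proof.
move=> r0; have b0 : 0 < `|b| + 1 by rewrite ltr_wpDl.
exists (r / (`|b| + 1)); first by rewrite divr_gt0.
move=> e e0; rewrite ler_pdivlMr // => er.
have : - (`|b| * e) <= b * e by rewrite -mulNr ler_pM2r // lerNl -normrN ler_norm.
lra.
Qed.

(** As [radial_super_test], with f'' raised: the forbidden conditions are open, so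
    they would persist for a small increase. *)
Lemma radial_sub_test p v a x (f f' : R -> R) f2 : radial_sub p v -> x != 0 ->
  let z := norm2 (x - a) in
  (\forall t \near z, is_derive t (1 : R) f (f' t)) -> is_derive z (1 : R) f' f2 ->
  v x = f z -> (\forall y \near x, v y <= f (norm2 (y - a))) ->
  let T := eig_tan z (f' z) in let Q := eig_rad z (f' z) f2 in
  ~ (0 < Q + (2 - p) * T /\ 0 < T + (2 - p) * Q).
Proof.
move=> V x0 z nf df' vx nx T Q [hQ hT].
have [d1 d10 hd1] := gt0_perturb (- (4 * z)) hQ.
have [d2 d20 hd2] := gt0_perturb (- ((2 - p) * (4 * z))) hT.
pose d := Num.min d1 d2.
have d0 : 0 < d by rewrite lt_min d10 d20.
apply: (V a x (f z) (f' z) (f2 + d) x0 vx).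
  have h := norm2B_continuous (taylor2_ge d0 nf df').
  by near=> y; apply: le_trans (_ : f (norm2 (y - a)) <= _); near: y => //.
have := hd1 d d0; have := hd2 d d0; rewrite !ge_min !lexx orbT /= => /(_ isT) k2 /(_ isT) k1.
by split; move: k1 k2; rewrite -/z /T /Q /eig_tan /eig_rad; lra.
Unshelve. all: by end_near.
Qed.
End Taylor.

(** * The explicit radial profiles *)

Section Profiles.
Variable R : realType.
Local Notation plane := 'rV[R]_2.
Implicit Types (x y a : plane) (p : R) (v : plane -> R).
Variables k A B c : R.
Hypothesis k0 : k != 0.

Definition weight (z : R) := A * z `^ k + B.
(** In terms of w = e^(-u/2), the profile with c = 0 is w^k = A z^k + B. For
    2k = p - 1 and A, B >= 0 these are the radial solutions; other exponents, or
    opposite signs, can give strict barriers. *)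
Definition profile (z : R) := c - 2 / k * ln (weight z).
Let dprofile (z : R) := - 2 * A * z `^ k / (z * weight z).

Lemma is_derive_powR (z : R) : 0 < z ->
  is_derive z (1 : R) (fun t => t `^ k) (k * z `^ k / z).
Proof.
move=> z0; apply: (is_derive_eq (is_derive1_powR k z0)).
rewrite powRB; last by apply/implyP => _; rewrite gt_eqF.
by rewrite powRr1 ?mulrA // ltW.
Qed.

Lemma is_derive_weight (z : R) : 0 < z ->
  is_derive z (1 : R) weight (A * (k * z `^ k / z)).
Proof.
move=> z0; have h := is_deriveD (is_deriveM (is_derive_cst A z (1 : R))
  (is_derive_powR z0)) (is_derive_cst B z (1 : R)).
by apply: (is_derive_eq h); rewrite /cst /GRing.scale /=; ring.
Qed.

Lemma is_derive_profile (z : R) : 0 < z -> 0 < weight z ->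
  is_derive z (1 : R) profile (dprofile z).
Proof.
move=> z0 w0; have hl := is_derive1_comp (is_derive1_ln w0) (is_derive_weight z0).
have h := is_deriveB (is_derive_cst c z (1 : R))
  (is_deriveM (is_derive_cst (2 / k) z (1 : R)) hl).
apply: (is_derive_eq h); rewrite /cst /GRing.scale /= /dprofile.
by field; rewrite k0 !gt_eqF.
Qed.

Lemma is_derive_dprofile (z : R) : 0 < z -> 0 < weight z ->
  is_derive z (1 : R) dprofile (2 * A * z `^ k / weight z / z ^+ 2 -
     2 * k * (A * z `^ k) * B / (weight z * z) ^+ 2).
Proof.
move=> z0 w0; have zw : z * weight z != 0 by rewrite mulf_neq0 // gt_eqF.
have h1 := is_deriveM (is_derive_cst (- 2 * A) z (1 : R)) (is_derive_powR z0).
have h2 := is_deriveM (is_derive_id z (1 : R)) (is_derive_weight z0).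
have h := is_deriveM h1 (@is_deriveV _ (fun t : R => t * weight t) z _ (1 : R) zw h2).
apply: (is_derive_eq h); rewrite /cst /GRing.scale /=.
have -> : ((fun=> - 2 * A) * (powR (R := R))^~ k) z = - 2 * A * z `^ k by [].
have -> : B = weight z - A * z `^ k by rewrite /weight; ring.
by field; rewrite !gt_eqF.
Qed.

(** Along a profile the radial eigenvalue is 2k - 1 times the tangential one,
    which has the sign of A * B. Both defining inequalities of the cone therefore
    reduce to the sign of a constant. *)
Lemma profile_eigs p (z : R) : 0 < z -> 0 < weight z ->
  let f1 := dprofile z in
  let f2 := 2 * A * z `^ k / weight z / z ^+ 2 -
     2 * k * (A * z `^ k) * B / (weight z * z) ^+ 2 in
  let E := 4 * z `^ k / (z * weight z ^+ 2) in
  eig_rad z f1 f2 + (2 - p) * eig_tan z f1 = E * ((2 * k - (p - 1)) * (A * B)) /\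
  eig_tan z f1 + (2 - p) * eig_rad z f1 f2 =
     E * ((p - 1 + 2 * k * (2 - p)) * (A * B)).
Proof.
move=> z0 w0 f1 f2 E; rewrite /f1 /f2 /E /eig_tan /eig_rad /dprofile.
have -> : B = weight z - A * z `^ k by rewrite /weight; ring.
by split; field; rewrite !gt_eqF.
Qed.

Lemma weight_near (z : R) : 0 < z -> 0 < weight z ->
  \forall t \near z, 0 < t /\ 0 < weight t.
Proof.
move=> z0 w0; have cw : {for z, continuous weight}.
  by have [] := is_derive_weight z0 => dw _; exact/differentiable_continuous/derivable1_diffP.
near=> t; split; near: t; first exact: lt_nbhsr.
exact: (cvgr_gt (weight z) cw).
Unshelve. all: by end_near.
Qed.

Lemma profile_super p v a x : radial_super p v -> x != 0 ->
  let z := norm2 (x - a) in 0 < z -> 0 < weight z ->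
  v x = profile z -> (\forall y \near x, profile (norm2 (y - a)) <= v y) ->
  0 <= (2 * k - (p - 1)) * (A * B) /\ 0 <= (p - 1 + 2 * k * (2 - p)) * (A * B).
Proof.
move=> V x0 z z0 w0 vx nx.
have nf : \forall t \near z, is_derive t (1 : R) profile (dprofile t).
  by apply: filterS (weight_near z0 w0) => t [t0 wt]; exact: is_derive_profile.
have := radial_super_test V x0 nf (is_derive_dprofile z0 w0) vx nx.
rewrite -/z; cbv zeta; have [-> ->] := profile_eigs p z0 w0.
have E0 : 0 < 4 * z `^ k / (z * weight z ^+ 2).
  by rewrite divr_gt0 ?mulr_gt0 ?powR_gt0 ?exprn_gt0.
by rewrite !(pmulr_rge0 _ E0).
Qed.

Lemma profile_sub p v a x : radial_sub p v -> x != 0 ->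
  let z := norm2 (x - a) in 0 < z -> 0 < weight z ->
  v x = profile z -> (\forall y \near x, v y <= profile (norm2 (y - a))) ->
  ~ (0 < (2 * k - (p - 1)) * (A * B) /\ 0 < (p - 1 + 2 * k * (2 - p)) * (A * B)).
Proof.
move=> V x0 z z0 w0 vx nx.
have nf : \forall t \near z, is_derive t (1 : R) profile (dprofile t).
  by apply: filterS (weight_near z0 w0) => t [t0 wt]; exact: is_derive_profile.
have := radial_sub_test V x0 nf (is_derive_dprofile z0 w0) vx nx.
rewrite -/z; cbv zeta; have [-> ->] := profile_eigs p z0 w0.
have E0 : 0 < 4 * z `^ k / (z * weight z ^+ 2).
  by rewrite divr_gt0 ?mulr_gt0 ?powR_gt0 ?exprn_gt0.
by rewrite !(pmulr_rgt0 _ E0).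
Qed.

End Profiles.

(** * Comparison with profiles on annuli *)

Section Comparison.
Variable R : realType.
Local Notation plane := 'rV[R]_2.
Implicit Types (x y a : plane) (p : R) (u v : plane -> R).

Definition annulus a (r1 r2 : R) : set plane := [set y | r1 <= norm2 (y - a) <= r2].

Lemma coord_le_norm2 y i : `|y ord0 i| <= norm2 y + 1.
Proof.
have h : y ord0 i ^+ 2 <= norm2 y.
  rewrite /norm2; case: i => -[|[|//]] hi.
    by rewrite (_ : Ordinal hi = 0) ?lerDl ?sqr_ge0 //; exact: val_inj.
  by rewrite (_ : Ordinal hi = 1) ?lerDr ?sqr_ge0 //; exact: val_inj.
rewrite ler_norml; nra.
Qed.

Lemma annulus_compact a r1 r2 : compact (annulus a r1 r2).
Proof.
apply: bounded_closed_compact.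
  exists (r2 + 1 + `|a|); split=> [|M hM y /andP[_ yr]]; first exact: num_real.
  apply: le_trans (ltW hM); rewrite -[y](subrK a) (le_trans (ler_normD _ _)) // lerD2r.
  rewrite [leLHS]/Num.norm /= mx_normrE; apply/bigmax_leP; split=> /=.
    by have := norm2_ge0 (y - a); lra.
  case=> i j _ /=; rewrite ord1; apply: le_trans (coord_le_norm2 _ _) _.
  by rewrite lerD2r.
rewrite (_ : annulus _ _ _ = (fun y => norm2 (y - a)) @^-1` `[r1, r2]%classic).
  apply: closed_comp => [y _|]; first exact: norm2B_continuous.
  exact: itv_closed.
by apply/seteqP; split=> y; rewrite /annulus /= in_itv.
Qed.

(** A negative minimum of v - h(|y - a|^2) over the compact annulus would be
    attained inside, where a translate of the smooth function touches [v]. No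
    comparison between two nonsmooth functions is involved. *)
Lemma annulus_comparison v (h : R -> R) a r1 r2 :
  (forall y, annulus a r1 r2 y -> {for y, continuous v}) ->
  (forall z, r1 <= z <= r2 -> {for z, continuous h}) ->
  (forall y, norm2 (y - a) = r1 \/ norm2 (y - a) = r2 -> h (norm2 (y - a)) <= v y) ->
  (forall x m, r1 < norm2 (x - a) < r2 -> v x = h (norm2 (x - a)) + m ->
    (\forall y \near x, h (norm2 (y - a)) + m <= v y) -> False) ->
  forall y, annulus a r1 r2 y -> h (norm2 (y - a)) <= v y.
Proof.
move=> cv ch bd notouch y yA.
pose d w := v w - h (norm2 (w - a)).
have cd : {within annulus a r1 r2, continuous d}.
  apply: continuous_in_subspaceT => w /set_mem wA; apply: continuousB; first exact: cv.
  apply: continuous_comp; first exact: norm2B_continuous.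
  by apply: ch.
have [|c /set_mem cA cmin] := EVT_min_rV _ (@annulus_compact a r1 r2) cd.
  by exists y.
have {}cmin w : annulus a r1 r2 w -> d c <= d w by move=> wA; apply: cmin; rewrite inE.
suff dc : 0 <= d c by rewrite -subr_ge0; apply: le_trans dc (cmin y yA).
rewrite leNgt; apply/negP => dc0.
have /andP[c1 c2] := cA.
have dcb : norm2 (c - a) = r1 \/ norm2 (c - a) = r2 -> False.
  by move=> /bd; move: dc0; rewrite /d; lra.
have {}c1 : r1 < norm2 (c - a).
  by rewrite lt_neqAle c1 andbT eq_sym; apply/eqP => e; apply: dcb; left.
have {}c2 : norm2 (c - a) < r2.
  by rewrite lt_neqAle c2 andbT; apply/eqP => e; apply: dcb; right.
apply: (notouch c (d c)); first by rewrite c1.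
  by rewrite /d; ring.
have cn := @norm2B_continuous R a c.
have n1 : \forall w \near c, r1 < norm2 (w - a) by exact: (cvgr_gt _ cn).
have n2 : \forall w \near c, norm2 (w - a) < r2 by exact: (cvgr_lt _ cn).
near=> w; have := cmin w; rewrite {2}/d => /(_ _)/wrap[]; last by rewrite lerBrDl.
by rewrite /annulus /=; apply/andP; split; apply: ltW; near: w.
Unshelve. all: by end_near.
Qed.

Lemma profile_continuous (k A B c z : R) : k != 0 -> 0 < z -> 0 < weight k A B z ->
  {for z, continuous (profile k A B c)}.
Proof.
move=> k0 z0 w0; have [dw _] := @is_derive_profile R k A B c k0 z z0 w0.
exact/differentiable_continuous/derivable1_diffP.
Qed.

Lemma profileD (k A B c m z : R) :
  profile k A B c z + m = profile k A B (c + m) z.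
Proof. by rewrite /profile; ring. Qed.

(** A profile is a strict barrier from below as soon as one of the two constants of
    [profile_super] is negative, for instance when 2k < p - 1 and A, B > 0, or when
    k = -(p-1)/2 and A < 0 < B. *)
Lemma super_comparison p v k A B c a r1 r2 : k != 0 -> radial_super p v -> 0 < r1 ->
  (forall y, annulus a r1 r2 y -> y != 0 /\ {for y, continuous v}) ->
  (forall z, r1 <= z <= r2 -> 0 < weight k A B z) ->
  (2 * k - (p - 1)) * (A * B) < 0 \/ (p - 1 + 2 * k * (2 - p)) * (A * B) < 0 ->
  (forall y, norm2 (y - a) = r1 \/ norm2 (y - a) = r2 ->
    profile k A B c (norm2 (y - a)) <= v y) ->
  forall y, annulus a r1 r2 y -> profile k A B c (norm2 (y - a)) <= v y.
Proof.
move=> k0 V r10 cv wpos AB bd.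
apply: annulus_comparison => [y /cv[]//|z zr|//|x m xr vx nx].
  apply: profile_continuous => //; last exact: wpos.
  by case/andP: zr => h _; exact: lt_le_trans h.
have xr' : r1 <= norm2 (x - a) <= r2 by case/andP: xr => /ltW -> /ltW ->.
have [x0 _] := cv x xr'.
have z0 : 0 < norm2 (x - a) by case/andP: xr => h _; exact: lt_trans h.
have [] := @profile_super R k A B (c + m) k0 p v a x V x0 z0 (wpos _ xr').
- by rewrite vx profileD.
- by apply: near_subset nx => y; rewrite profileD.
- by move=> h1 h2; case: AB; rewrite ltNge ?h1 ?h2.
Qed.

Lemma sub_comparison p v k A B c a r1 r2 : k != 0 -> radial_sub p v -> 0 < r1 ->
  (forall y, annulus a r1 r2 y -> y != 0 /\ {for y, continuous v}) ->
  (forall z, r1 <= z <= r2 -> 0 < weight k A B z) ->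
  0 < (2 * k - (p - 1)) * (A * B) -> 0 < (p - 1 + 2 * k * (2 - p)) * (A * B) ->
  (forall y, norm2 (y - a) = r1 \/ norm2 (y - a) = r2 ->
    v y <= profile k A B c (norm2 (y - a))) ->
  forall y, annulus a r1 r2 y -> v y <= profile k A B c (norm2 (y - a)).
Proof.
move=> k0 V r10 cv wpos AB1 AB2 bd y yA; rewrite -lerN2.
apply: (@annulus_comparison (fun y => - v y) (fun z => - profile k A B c z)) yA.
- by move=> {}y /cv[_ ?]; exact: continuousN.
- move=> z zr; apply: continuousN; apply: profile_continuous => //; last exact: wpos.
  by case/andP: zr => h _; exact: lt_le_trans h.
- by move=> {}y /bd; rewrite lerN2.
move=> x m xr vx nx.
have xr' : r1 <= norm2 (x - a) <= r2 by case/andP: xr => /ltW -> /ltW ->.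
have [x0 _] := cv x xr'.
have z0 : 0 < norm2 (x - a) by case/andP: xr => h _; exact: lt_trans h.
apply: (@profile_sub R k A B (c - m) k0 p v a x V x0 z0 (wpos _ xr')) => //.
- by rewrite -profileD -[LHS]opprK vx; ring.
- by apply: near_subset nx => w; rewrite -profileD; lra.
Qed.

End Comparison.

(** * Supersolutions near the puncture *)

Section Supersolutions.
Variable R : realType.
Local Notation plane := 'rV[R]_2.
Implicit Types (x y a : plane).
Variables (p : R) (v : plane -> R).
Hypothesis hp : 1 < p <= 2.
Hypothesis cv : forall x, x != 0 -> {for x, continuous v}.
Hypothesis V : radial_super p v.

Lemma powRK (b t : R) : b != 0 -> 0 <= t -> (t `^ b^-1) `^ b = t.
Proof. by move=> b0 t0; rewrite -powRrM mulVf // powRr1. Qed.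

Lemma powRV (b t : R) : 0 <= t -> t^-1 `^ b = (t `^ b)^-1.
Proof. by move=> t0; rewrite -powR_inv1 // -powRrM mulN1r powRN. Qed.

Lemma ler_powR_base (b s t : R) : 0 <= b -> 0 <= s -> s <= t -> s `^ b <= t `^ b.
Proof. by move=> b0 s0 st; apply: ge0_ler_powR => //; rewrite nnegrE // (le_trans s0). Qed.

Lemma annulus0_neq0 r1 r2 y : 0 < r1 -> annulus 0 r1 r2 y -> y != 0.
Proof.
by move=> r10 /andP[h _]; rewrite -norm2_gt0; move: h; rewrite subr0; exact: lt_le_trans.
Qed.

Lemma annulus0_lower r1 r2 : 0 < r1 -> exists m, forall y, annulus 0 r1 r2 y -> m <= v y.
Proof.
move=> r10; have [[y yA]|hn] := pselect (annulus 0 r1 r2 !=set0); last first.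
  by exists 0 => y yA; exfalso; apply: hn; exists y.
have cw : {within annulus 0 r1 r2, continuous v}.
  by apply: continuous_in_subspaceT => w /set_mem /(annulus0_neq0 r10); exact: cv.
have [|c _ cmin] := EVT_min_rV _ (@annulus_compact R 0 r1 r2) cw; first by exists y.
by exists (v c) => w wA; apply: cmin; rewrite inE.
Qed.

(** The minimum over circles about 0 is nonincreasing in the radius, though
    nothing is known of [v] near 0: the barrier with exponent -(p-1)/2 and
    A < 0 < B tends to minus infinity on an inner circle, whose radius can be made
    as small as desired while the barrier tends to [C]. *)
Lemma super_inner_min (rho C : R) : (forall y, norm2 y = rho -> C <= v y) ->
  forall y, 0 < norm2 y <= rho -> C <= v y.
Proof.
move=> bd y /andP[]; set z := norm2 y => z0.
rewrite le_eqVlt => /predU1P[/bd//|zr]; rewrite leNgt; apply/negP => vC.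
have rho0 : 0 < rho by exact: lt_trans zr.
pose s := p - 1; have s0 : 0 < s by rewrite /s; move: hp; lra.
pose b := s / 2; have b0 : 0 < b by rewrite divr_gt0.
have bn0 : b != 0 by rewrite gt_eqF.
(* [eta] is the value at [y] of the weight of the barrier, chosen so that the
   barrier at [y] is the midpoint of [v y] and [C]. *)
pose eta := expR (s / 8 * (v y - C)).
have eta0 : 0 < eta by exact: expR_gt0.
have eta1 : eta < 1 by rewrite expR_lt1 pmulr_rlt0 ?divr_gt0 // subr_lt0.
pose A := - ((1 - eta) * z `^ b).
have zb : 0 < z `^ b by exact: powR_gt0.
have A0 : A < 0 by rewrite oppr_lt0 mulr_gt0 // subr_gt0.
(* The weight vanishes at [rs]; the comparison starts at [r1], where it equals
   [d] and the barrier is below the minimum [m] of [v] on the larger annulus. *)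
pose rs := (- A) `^ b^-1.
have rs0 : 0 < rs by rewrite powR_gt0 // oppr_gt0.
have [m hm] := annulus0_lower rho rs0.
pose d := Num.min (eta / 2) (expR (s / 4 * (m - C))).
have d0 : 0 < d by rewrite lt_min expR_gt0 andbT divr_gt0.
have d1 : d < eta by rewrite gt_min; apply/orP; left; lra.
pose r1 := (- A / (1 - d)) `^ b^-1.
have d1' : 0 < 1 - d by lra.
have Ad : 0 < - A / (1 - d) by rewrite divr_gt0 // oppr_gt0.
have r10 : 0 < r1 by exact: powR_gt0.
have rsr1 : rs <= r1.
  apply: ler_powR_base; [by rewrite invr_ge0 ltW|by rewrite oppr_ge0 ltW|].
  by rewrite ler_pdivlMr // ger_pMr ?oppr_gt0 //; lra.
have wE t : weight (- b) A 1 t = 1 - (- A) / t `^ b.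
  by rewrite /weight powRN; ring.
have wr1 : weight (- b) A 1 r1 = d.
  rewrite wE powRK // ?ltW // invf_div mulrCA divff ?mulr1; first by ring.
  by rewrite gt_eqF // oppr_gt0.
have wmono t1 t2 : 0 < t1 -> t1 <= t2 -> weight (- b) A 1 t1 <= weight (- b) A 1 t2.
  move=> t10 t12; rewrite !wE lerD2l lerN2 ler_pM2l ?oppr_gt0 // lef_pV2 ?posrE ?powR_gt0 //.
    by apply: ler_powR_base => //; exact: ltW.
  exact: lt_le_trans t12.
have wz : weight (- b) A 1 z = eta.
  by rewrite wE /A opprK mulfK ?gt_eqF //; ring.
have wr : weight (- b) A 1 rho <= 1.
  by rewrite wE gerBl divr_ge0 ?powR_ge0 // oppr_ge0 ltW.
have pE t : profile (- b) A 1 C t = C + 4 / s * ln (weight (- b) A 1 t).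
  by rewrite /profile /b; field; rewrite gt_eqF.
have r1z : r1 <= z.
  rewrite leNgt; apply/negP => zr1; have := wmono z r1 z0 (ltW zr1).
  by rewrite wz wr1 leNgt d1.
have : profile (- b) A 1 C (norm2 (y - 0)) <= v y.
  apply: (@super_comparison R p v (- b) A 1 C 0 r1 rho) => //.
  - by rewrite oppr_eq0.
  - move=> w /(annulus0_neq0 r10) w0; split=> //; exact: cv.
  - move=> t /andP[t1 _]; apply: lt_le_trans (wmono _ _ r10 t1); by rewrite wr1.
  - right; rewrite (_ : _ * _ = s ^+ 2 * A); last by rewrite /b /s; field.
    by rewrite pmulr_rlt0 // exprn_gt0.
  - move=> w; rewrite subr0 => -[] wN; rewrite wN.
      apply: le_trans (_ : m <= _); last first.
        by apply: hm; rewrite /annulus /= subr0 wN rsr1 /= ltW // (le_lt_trans r1z).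
      rewrite pE wr1 -lerBrDl -ler_pdivlMl ?divr_gt0 // invf_div.
      rewrite -[leRHS]expRK ler_ln ?posrE ?expR_gt0 //.
      by rewrite ge_min lexx orbT.
    apply: le_trans (bd w wN); rewrite pE gerDl pmulr_rle0 ?divr_gt0 //.
    exact: ln_le0.
  - by rewrite /annulus /= subr0 r1z ltW.
rewrite subr0 pE wz expRK; have -> : 4 / s * (s / 8 * (v y - C)) = (v y - C) / 2.
  by field; rewrite gt_eqF.
by lra.
Qed.

Let k := (p - 1) / 4.
Let k_gt0 : 0 < k. Proof. by rewrite /k divr_gt0 // subr_gt0; case/andP: hp. Qed.

(** The power w^t of w = e^(-v/2), the quantity that is affine in |y|^(2t) along
    profiles of exponent [t]. *)
Definition conf_pow (t : R) y := expR (- (t / 2) * v y).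
Local Notation G := (conf_pow k).

Lemma conf_pow_gt0 t y : 0 < conf_pow t y. Proof. exact: expR_gt0. Qed.

Lemma conf_pow_le_weight t A B y z : 0 < t -> 0 < weight t A B z ->
  (conf_pow t y <= weight t A B z) = (profile t A B 0 z <= v y).
Proof.
move=> t0 w0; rewrite /conf_pow /profile sub0r -{1}[weight t A B z]lnK ?posrE //.
rewrite ler_expR mulNr lerNl -ler_pdivrMl ?divr_gt0 // invf_div.
by rewrite mulrN.
Qed.

Lemma conf_pow_continuous t x : x != 0 -> {for x, continuous (conf_pow t)}.
Proof.
move=> x0; apply: continuous_comp; last exact: continuous_expR.
by apply: continuousM; [exact: cst_continuous|exact: cv].
Qed.

Lemma norm2_nbhs x (P : plane -> Prop) : (\forall y \near x, P y) ->
  exists2 r, 0 < r & forall y, norm2 (y - x) < r -> P y.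
Proof.
move=> /nbhs_ballP[e /= e0 he]; exists (e ^+ 2); first by rewrite exprn_gt0.
move=> y yx; apply: he; rewrite -ball_normE /= distrC.
rewrite [ltLHS]/Num.norm /= mx_normrE; apply/bigmax_ltP; split=> //=.
case=> i j _ /=; rewrite ord1 -(ltr_pXn2r (ltn0Sn 1)) ?nnegrE // ?(ltW e0) //.
apply: le_lt_trans yx; rewrite real_normK ?num_real // /norm2.
case: j => -[|[|//]] hj.
  by rewrite (_ : Ordinal hj = 0) ?lerDl ?sqr_ge0 //; exact: val_inj.
by rewrite (_ : Ordinal hj = 1) ?lerDr ?sqr_ge0 //; exact: val_inj.
Qed.

(** A profile with exponent k > 0 is finite at its centre, that is, points have
    positive capacity when p > 1. Placing its pole at the centre of a ball and
    matching the bound [K] on the boundary turns comparison into a Harnack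
    inequality for K - w^k that uses only the supersolution property. *)
Lemma harnack_ball K x r : 0 < r < norm2 x ->
  (forall y, norm2 (y - x) <= r -> G y <= K) ->
  forall y, 0 < norm2 (y - x) <= r ->
  (1 - (norm2 (y - x) / r) `^ k) * (K - G x) <= K - G y.
Proof.
move=> /andP[r0 rx] hK y /andP[]; set z := norm2 (y - x) => z0 zr.
have kn0 : k != 0 by rewrite gt_eqF.
have x0 : x != 0 by rewrite -norm2_gt0 (lt_trans r0).
have xK : G x <= K by apply: hK; rewrite subrr /norm2 !mxE expr0n addr0 ltW.
set t := (z / r) `^ k.
have t1 : t <= 1.
  have one : (1 : R) `^ k = 1 by rewrite powR1.
  rewrite -[leRHS]one; apply: ler_powR_base; first exact: ltW.
    by rewrite divr_ge0 ?norm2_ge0 // ltW.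
  by rewrite ler_pdivrMr // mul1r.
have t0 : 0 <= t by exact: powR_ge0.
have rk : 0 < r `^ k by exact: powR_gt0.
(* The value of the barrier weight at its pole exceeds [G x] by [e / 2], which
   makes the comparison true near the centre by continuity. *)
apply/ler_addgt0Pr => e e0.
pose A := (K - G x + e / 2) / r `^ k; pose B := G x + e / 2.
have A0 : 0 < A by rewrite divr_gt0 //; lra.
have B0 : 0 < B by rewrite /B; have := conf_pow_gt0 k x; lra.
have W0 w : 0 < weight k A B w by rewrite ltr_wpDl // mulr_ge0 ?powR_ge0 // ltW.
have [q q0 hq] : exists2 q, 0 < q & forall w, norm2 (w - x) < q -> G w < B.
  have gc : {for x, continuous G} by exact: conf_pow_continuous.
  have GB : G x < B by rewrite /B; lra.
  by apply: norm2_nbhs; exact: (cvgr_lt _ gc).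
pose r1 := Num.min z (q / 2).
have r10 : 0 < r1 by rewrite lt_min z0 divr_gt0.
have r1q : r1 < q by rewrite gt_min; apply/orP; right; lra.
have : profile k A B 0 z <= v y.
  apply: (@super_comparison R p v k A B 0 x r1 r) => //.
  - move=> w /andP[_ wr]; suff w0 : w != 0 by split=> //; exact: cv.
    apply/eqP => w0; move: wr; rewrite w0 sub0r.
    by rewrite /norm2 !mxE !sqrrN leNgt -/(norm2 x) rx.
  - by left; rewrite nmulr_rlt0; [exact: mulr_gt0|rewrite /k; move: hp; lra].
  - move=> w wN; rewrite -conf_pow_le_weight //; case: wN => wN.
      apply: le_trans (ltW (hq w _)) _; first by rewrite wN.
      by rewrite /weight lerDr mulr_ge0 ?powR_ge0 // ltW.
    rewrite wN; apply: le_trans (hK w _) _; first by rewrite wN.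
    by rewrite /weight /A divfK ?gt_eqF // /B; lra.
  - by rewrite /annulus /= -/z zr andbT ge_min lexx.
rewrite -conf_pow_le_weight // => h.
have : G y <= (K - G x + e / 2) * t + B.
  apply: le_trans h _; rewrite /weight /A /t powRM ?invr_ge0 ?(ltW z0) ?(ltW r0) //.
  by rewrite powRV ?(ltW r0) // mulrAC mulrA.
have : e / 2 * t <= e / 2 by rewrite ger_pMr // divr_gt0.
by rewrite /B; lra.
Qed.


Definition rotate (sg : R) x : plane :=
  \row_i (if i == 0 then 3 / 5 * x ord0 0 - 4 / 5 * sg * x ord0 1
          else 4 / 5 * sg * x ord0 0 + 3 / 5 * x ord0 1).
Definition dot x y : R := x ord0 0 * y ord0 0 + x ord0 1 * y ord0 1.
Definition cross x y : R := x ord0 0 * y ord0 1 - x ord0 1 * y ord0 0.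

Let mu := 1 - (8 / 9) `^ k.

(** [mu] is the fraction of K - w^k preserved by one application of [harnack_ball]
    with squared radius 9/10 and squared distance at most 8/10, in units of
    |x|^2. *)
Lemma mu_bounds : 0 < mu <= 1.
Proof.
rewrite subr_gt0 gerBl powR_ge0 andbT -[ltRHS](powRr0 (8 / 9)).
have -> : (8 / 9 : R) `^ k = expR (k * ln (8 / 9)).
  by rewrite /powR gt_eqF // divr_gt0.
rewrite powRr0 expR_lt1 pmulr_rlt0 // ln_lt0 //.
by apply/andP; split; lra.
Qed.

Section Circle.
Variables (K rho : R).
Hypothesis rho0 : 0 < rho.
Hypothesis hK : forall y, 0 < norm2 y <= 4 * rho -> G y <= K.

(** Two points of the circle making an angle of cosine at least 3/5 are at
    squared distance at most 8/10 of [rho]; the ball of squared radius 9/10 [rho]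
    avoids the puncture and stays where [hK] applies. *)
Lemma harnack_step x y : norm2 x = rho -> norm2 y = rho -> 3 / 5 * rho <= dot x y ->
  mu * (K - G x) <= K - G y.
Proof.
move=> xr yr xy; have /andP[mu0 mu1] := mu_bounds.
have xK : 0 <= K - G x by rewrite subr_ge0; apply: hK; rewrite xr rho0 /=; move: rho0; lra.
have dE : norm2 (y - x) = 2 * rho - 2 * dot x y.
  by move: xr yr; rewrite /norm2 /dot !mxE; lra.
have [e|yx0] := eqVneq (norm2 (y - x)) 0.
  suff -> : y = x by exact: ler_piMl.
  by apply/eqP; rewrite -subr_eq0; apply: contraT; rewrite -norm2_gt0 e ltxx.
have yx : 0 < norm2 (y - x) by rewrite lt_neqAle eq_sym yx0 norm2_ge0.
have hr : 0 < 9 / 10 * rho < norm2 x by rewrite xr; move: rho0; lra.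
have ball w : norm2 (w - x) <= 9 / 10 * rho -> G w <= K.
  move=> wx; apply: hK; rewrite norm2_gt0; apply/andP; split.
    apply/eqP => w0; move: wx; rewrite w0 sub0r -scaleN1r norm2Z xr; move: rho0; lra.
  have := sqr_ge0 (w ord0 0 - 2 * x ord0 0); have := sqr_ge0 (w ord0 1 - 2 * x ord0 1).
  by move: wx xr rho0; rewrite /norm2 !mxE; lra.
apply: le_trans (harnack_ball hr ball (y := y) _); last first.
  by rewrite yx dE; move: xy; lra.
rewrite ler_wpM2r // /mu lerD2l lerN2; apply: ler_powR_base; first exact: ltW.
  by rewrite divr_ge0 ?norm2_ge0 //; move: rho0; lra.
rewrite ler_pdivrMr ?dE; move: rho0 xy; lra.
Qed.

Lemma rotateE sg x y : sg ^+ 2 = 1 -> [/\ norm2 (rotate sg x) = norm2 x,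
  dot x (rotate sg x) = 3 / 5 * norm2 x,
  dot (rotate sg x) y = 3 / 5 * dot x y + 4 / 5 * (sg * cross x y) &
  sg * cross (rotate sg x) y = 3 / 5 * (sg * cross x y) - 4 / 5 * dot x y].
Proof.
move=> sg2; have sgE : sg * sg = 1 by rewrite -expr2.
have E0 : rotate sg x ord0 0 = 3 / 5 * x ord0 0 - 4 / 5 * sg * x ord0 1 by rewrite mxE.
have E1 : rotate sg x ord0 1 = 4 / 5 * sg * x ord0 0 + 3 / 5 * x ord0 1 by rewrite mxE.
rewrite /norm2 /dot /cross E0 E1; split.
- transitivity ((3 / 5 * x ord0 0) ^+ 2 + (3 / 5 * x ord0 1) ^+ 2 +
    (sg * sg) * ((4 / 5 * x ord0 0) ^+ 2 + (4 / 5 * x ord0 1) ^+ 2)); first by field.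
  by rewrite sgE; field.
- by field.
- by field.
- transitivity (3 / 5 * (sg * (x ord0 0 * y ord0 1 - x ord0 1 * y ord0 0)) -
    (sg * sg) * (4 / 5 * (x ord0 0 * y ord0 0 + x ord0 1 * y ord0 1))); first by field.
  by rewrite sgE; field.
Qed.

Lemma lagrange2 sg x y : sg ^+ 2 = 1 ->
  dot x y ^+ 2 + (sg * cross x y) ^+ 2 = norm2 x * norm2 y.
Proof. by rewrite exprMn => ->; rewrite /dot /cross /norm2; ring. Qed.

Lemma harnack_rotate sg x y n : sg ^+ 2 = 1 -> norm2 x = rho ->
  (mu ^+ n * (K - G (rotate sg x)) <= K - G y) -> mu ^+ n.+1 * (K - G x) <= K - G y.
Proof.
move=> sg2 xr; apply: le_trans; have /andP[mu0 mu1] := mu_bounds.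
have [r1 r2 _ _] := rotateE x x sg2.
rewrite exprSr -mulrA ler_pM2l ?exprn_gt0 //.
by apply: harnack_step; rewrite ?r1 // r2 xr.
Qed.

Lemma harnack_weaken x y n m : norm2 x = rho -> (n <= m)%N ->
  mu ^+ n * (K - G x) <= K - G y -> mu ^+ m * (K - G x) <= K - G y.
Proof.
move=> xr nm; have /andP[mu0 mu1] := mu_bounds; apply: le_trans.
apply: ler_wpM2r; last by apply: ler_wiXn2l; rewrite // ltW.
by rewrite subr_ge0; apply: hK; rewrite xr rho0 /=; move: rho0; lra.
Qed.

(** Rotating towards [y] by the angle of cosine 3/5 and sine 4/5 at most three
    times brings any point of the circle within reach of [harnack_step]. Rational
    rotations keep the induction polynomial. *)
Lemma harnack_circle x y : norm2 x = rho -> norm2 y = rho ->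
  mu ^+ 4 * (K - G x) <= K - G y.
Proof.
move=> xr yr.
suff S3 sg : sg ^+ 2 = 1 -> 0 <= sg * cross x y -> mu ^+ 4 * (K - G x) <= K - G y.
  have [c0|c0] := leP 0 (cross x y).
    by apply: (S3 1); rewrite ?expr1n // mul1r.
  by apply: (S3 (- 1)); rewrite ?sqrrN ?expr1n // mulN1r oppr_ge0 ltW.
move=> sg2; move: x xr.
have S0 x : norm2 x = rho -> 3 / 5 * rho <= dot x y -> mu ^+ 1 * (K - G x) <= K - G y.
  by move=> xr; exact: harnack_step.
(* If the cosine of the angle to [y] is at least -1, -9/10 or -1/4, one rotation
   brings it to at least -9/10, -1/4 or 3/5 respectively, or else the next
   threshold was already met. *)
have S1 x : norm2 x = rho -> 0 <= sg * cross x y -> - (1 / 4) * rho <= dot x y ->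
    mu ^+ 2 * (K - G x) <= K - G y.
  move=> xr cr dr; have [h|h] := leP (3 / 5 * rho) (dot x y).
    exact: (harnack_weaken xr _ (S0 x xr h)).
  have [r1 _ r3 _] := rotateE x y sg2; have := lagrange2 x y sg2; rewrite xr yr => lg.
  apply: (harnack_rotate sg2 xr); apply: S0; rewrite ?r1 // r3; move: rho0; nra.
have S2 x : norm2 x = rho -> 0 <= sg * cross x y -> - (9 / 10) * rho <= dot x y ->
    mu ^+ 3 * (K - G x) <= K - G y.
  move=> xr cr dr; have [h|h] := leP (- (1 / 4) * rho) (dot x y).
    exact: (harnack_weaken xr _ (S1 x xr cr h)).
  have [r1 _ r3 r4] := rotateE x y sg2; have := lagrange2 x y sg2; rewrite xr yr => lg.
  apply: (harnack_rotate sg2 xr); apply: S1; rewrite ?r1 // ?r3 ?r4; first by move: rho0; lra.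
  by move: rho0; nra.
move=> x xr cr; have [h|h] := leP (- (9 / 10) * rho) (dot x y).
  exact: (harnack_weaken xr _ (S2 x xr cr h)).
have [r1 _ r3 r4] := rotateE x y sg2; have := lagrange2 x y sg2; rewrite xr yr => lg.
apply: (harnack_rotate sg2 xr); apply: S2; rewrite ?r1 // ?r3 ?r4; first by move: rho0; lra.
by move: rho0; nra.
Qed.

End Circle.

Lemma ler_conf_pow t x y : 0 < t -> (conf_pow t y <= conf_pow t x) = (v x <= v y).
Proof. by move=> t0; rewrite ler_expR !mulNr lerN2 ler_pM2l // divr_gt0. Qed.

Lemma circle_max y : y != 0 -> exists2 x, norm2 x = norm2 y &
  forall w, norm2 w = norm2 y -> G w <= G x.
Proof.
move=> y0; have r0 : 0 < norm2 y by rewrite norm2_gt0.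
have cw : {within annulus 0 (norm2 y) (norm2 y), continuous G}.
  apply: continuous_in_subspaceT => w /set_mem /(annulus0_neq0 r0) w0.
  exact: conf_pow_continuous.
have AE w : annulus 0 (norm2 y) (norm2 y) w <-> norm2 w = norm2 y.
  by rewrite /annulus /= subr0 -eq_le; split=> [/eqP|->].
have [|x /set_mem /AE xy xmax] := EVT_max_rV _ (@annulus_compact R 0 _ _) cw.
  by exists y; exact/AE.
by exists x => // w /AE wy; apply: xmax; rewrite inE.
Qed.

Lemma circle_max_disc x : x != 0 -> (forall w, norm2 w = norm2 x -> G w <= G x) ->
  forall w, 0 < norm2 w <= norm2 x -> G w <= G x.
Proof.
move=> x0 xmax w wx; rewrite ler_conf_pow //; apply: super_inner_min wx => t tx.
by rewrite -(@ler_conf_pow k) // xmax.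
Qed.

(** Since the circle maxima of w^k are nondecreasing in the radius, they decrease
    to a limit [L] at 0; when two circles of comparable radii have nearly the same
    maximum, [harnack_circle] forces w^k to be nearly constant on the smaller one.
    If w^k <= L everywhere, the bound [K] = L leaves no room at all and w^k is
    constant. The limit may be 0, meaning that [v] tends to infinity. *)
Lemma conf_pow_limit : exists L, [/\ 0 <= L,
  forall e, 0 < e -> exists2 r, 0 < r &
    forall y, 0 < norm2 y <= r -> L - e <= G y <= L + e &
  (forall y, y != 0 -> G y <= L) -> forall y, y != 0 -> G y = L].
Proof.
pose S := [set C | exists2 r, 0 < r & forall y, 0 < norm2 y <= r -> G y <= C].
have e1 (r : R) : 0 < r -> norm2 (Num.sqrt r *: dirv 0 : plane) = r.
  move=> r0; rewrite norm2Z sqr_sqrtr ?ltW // /norm2 /dirv !mxE /=.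
  by rewrite expr1n expr0n addr0 mulr1.
have S_max x : x != 0 -> (forall w, norm2 w = norm2 x -> G w <= G x) -> S (G x).
  by move=> x0 xmax; exists (norm2 x); [rewrite norm2_gt0|exact: circle_max_disc].
have S0 : S !=set0.
  have u0 : (Num.sqrt 1 *: dirv 0 : plane) != 0 by rewrite -norm2_gt0 e1.
  have [x xu xmax] := circle_max u0; exists (G x); apply: S_max.
    by rewrite -norm2_gt0 xu norm2_gt0.
  by move=> w; rewrite xu; exact: xmax.
have lbS C : S C -> 0 <= C.
  move=> [r r0 /(_ (Num.sqrt r *: dirv 0))]; rewrite e1 // r0 lexx => /(_ isT).
  by apply: le_trans; rewrite ltW ?conf_pow_gt0.
have infS : has_inf S by split=> //; exists 0 => C /lbS.
pose L := inf S.
have LS C : S C -> L <= C by move=> SC; apply: ge_inf => //; case: infS.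
have maxL y : y != 0 -> exists x, [/\ norm2 x = norm2 y, G y <= G x & L <= G x].
  move=> y0; have [x xy xmax] := circle_max y0; exists x; split=> //.
    exact: xmax.
  apply/LS/S_max; first by rewrite -norm2_gt0 xy norm2_gt0.
  by move=> w; rewrite xy; exact: xmax.
have /andP[mu0 mu1] := mu_bounds; have mu4 : 0 < mu ^+ 4 by rewrite exprn_gt0.
exists L; split.
- by apply: lb_le_inf => // C /lbS.
- move=> e e0; have d0 : 0 < e * mu ^+ 4 by rewrite mulr_gt0.
  have de : e * mu ^+ 4 <= e by rewrite ger_pMr // exprn_ile1 // ltW.
  have [C [r r0 hr] CL] := inf_adherent d0 infS.
  (* The factor 4 is the ratio of squared radii in [hK]. *)
  exists (r / 4) => [|y /andP[y0 yr]]; first by rewrite divr_gt0.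
  have yC : G y <= C by apply: hr; rewrite y0 /=; lra.
  apply/andP; split; last by rewrite -/L in CL; lra.
  have yn0 : y != 0 by rewrite -norm2_gt0.
  have [x [xy _ xL]] := maxL y yn0.
  have hC w : 0 < norm2 w <= 4 * norm2 y -> G w <= C.
    by move=> /andP[w0 wy]; apply: hr; rewrite w0 /=; lra.
  have := harnack_circle y0 hC erefl xy.
  have : C - G x < e * mu ^+ 4 by rewrite -/L in CL; lra.
  move=> h1 h2; have : mu ^+ 4 * (C - G y) < mu ^+ 4 * e.
    by rewrite [ltRHS]mulrC; exact: le_lt_trans h2 h1.
  rewrite ltr_pM2l // => h3.
  have : L <= C by apply: LS; exists r.
  lra.
- move=> GL y y0; have [x [xy _ xL]] := maxL y y0.
  have yp : 0 < norm2 y by rewrite norm2_gt0.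
  have hC w : 0 < norm2 w <= 4 * norm2 y -> G w <= L.
    by rewrite norm2_gt0 => /andP[w0 _]; exact: GL.
  have h := harnack_circle yp hC erefl xy.
  have : mu ^+ 4 * (L - G y) <= mu ^+ 4 * 0 by rewrite mulr0; lra.
  rewrite ler_pM2l // => h2; apply: le_anti; rewrite GL //=; lra.
Qed.

End Supersolutions.

(** * Comparison up to both ends *)

Section TwoEnds.
Variable R : realType.
Local Notation plane := 'rV[R]_2.
Implicit Types (x y : plane).
Variables (p : R) (u : plane -> R).
Hypothesis hp : 1 < p <= 2.
Hypothesis cu : forall x, x != 0 -> {for x, continuous u}.
Hypothesis Usup : radial_super p u.
Hypothesis Usub : radial_sub p u.
Hypothesis Uker : radial_super p (kelvin_transform u).

Lemma weight_gt0 (t A B z : R) : 0 <= A -> 0 < B -> 0 < weight t A B z.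
Proof. by move=> A0 B0; rewrite ltr_wpDl // mulr_ge0 ?powR_ge0. Qed.

Lemma squeeze_annulus r1 r2 y : 0 < r1 -> y != 0 ->
  let A := annulus 0 (Num.min r1 (norm2 y)) (Num.max r2 (norm2 y)) in
  [/\ 0 < Num.min r1 (norm2 y), A y &
   forall w, A w -> w != 0 /\ {for w, continuous u}].
Proof.
move=> r10 y0; have m0 : 0 < Num.min r1 (norm2 y) by rewrite lt_min r10 norm2_gt0.
split=> //; first by rewrite /annulus /= subr0 ge_min lexx orbT le_max lexx orbT.
by move=> w /(annulus0_neq0 m0) w0; split=> //; exact: cu.
Qed.

(** Profiles with 2t < p - 1 lie below [u] as soon as they do near both ends, since
    the annulus on which they are compared can be taken to contain any given
    point. *)
Lemma super_squeeze t A B c r1 r2 : 0 < t -> 2 * t < p - 1 -> 0 < A -> 0 < B -> 0 < r1 ->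
  (forall y, 0 < norm2 y <= r1 -> profile t A B c (norm2 y) <= u y) ->
  (forall y, y != 0 -> r2 <= norm2 y -> profile t A B c (norm2 y) <= u y) ->
  forall y, y != 0 -> profile t A B c (norm2 y) <= u y.
Proof.
move=> t0 tp A0 B0 r10 h1 h2 y y0; have [m0 yA cA] := squeeze_annulus r2 r10 y0.
have tn0 : t != 0 by rewrite gt_eqF.
have := @super_comparison R p u t A B c 0 _ _ tn0 Usup m0 cA
  (fun z _ => weight_gt0 t z (ltW A0) B0) _ _ y yA.
rewrite subr0; apply.
  by left; rewrite nmulr_rlt0 ?mulr_gt0 //; lra.
move=> w; rewrite subr0 => -[] wN.
  have w0 : 0 < norm2 w by rewrite wN.
  by apply: h1; rewrite w0 wN ge_min lexx.
have w0 : 0 < norm2 w by rewrite wN lt_max norm2_gt0 y0 orbT.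
by apply: h2; [rewrite -norm2_gt0|rewrite wN le_max lexx].
Qed.

Lemma sub_squeeze t A B c r1 r2 : 0 < t -> p - 1 < 2 * t -> 0 < A -> 0 < B -> 0 < r1 ->
  (forall y, 0 < norm2 y <= r1 -> u y <= profile t A B c (norm2 y)) ->
  (forall y, y != 0 -> r2 <= norm2 y -> u y <= profile t A B c (norm2 y)) ->
  forall y, y != 0 -> u y <= profile t A B c (norm2 y).
Proof.
move=> t0 tp A0 B0 r10 h1 h2 y y0; have [m0 yA cA] := squeeze_annulus r2 r10 y0.
have tn0 : t != 0 by rewrite gt_eqF.
have AB : 0 < A * B by exact: mulr_gt0.
have := @sub_comparison R p u t A B c 0 _ _ tn0 Usub m0 cA
  (fun z _ => weight_gt0 t z (ltW A0) B0) _ _ _ y yA.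
rewrite subr0; apply.
- by rewrite pmulr_lgt0 // subr_gt0.
- rewrite pmulr_lgt0 // ltr_wpDr // ?subr_gt0; last by case/andP: hp.
  apply: mulr_ge0; first by rewrite mulr_ge0 // ltW.
  by rewrite subr_ge0; case/andP: hp.
move=> w; rewrite subr0 => -[] wN.
  have w0 : 0 < norm2 w by rewrite wN.
  by apply: h1; rewrite w0 wN ge_min lexx.
have w0 : 0 < norm2 w by rewrite wN lt_max norm2_gt0 y0 orbT.
by apply: h2; [rewrite -norm2_gt0|rewrite wN le_max lexx].
Qed.

Lemma conf_pow_kelvin t x : x != 0 ->
  conf_pow u t x = conf_pow (kelvin_transform u) t (kelvin x) * norm2 x `^ t.
Proof.
rewrite -norm2_gt0 => x0; rewrite /conf_pow kelvin_transformE -?norm2_gt0 //.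
by rewrite /powR gt_eqF // -expRD; congr expR; field.
Qed.

Let k := (p - 1) / 4.
Let k0 : 0 < k. Proof. by rewrite /k divr_gt0 // subr_gt0; case/andP: hp. Qed.

Lemma limit_of_conf_pow (v : plane -> R) L : 0 < L ->
  (forall e, 0 < e -> exists2 r, 0 < r &
    forall y, 0 < norm2 y <= r -> L - e <= conf_pow v k y <= L + e) ->
  forall e, 0 < e -> exists2 r, 0 < r & forall y, 0 < norm2 y <= r ->
    - (2 / k) * ln L - e <= v y <= - (2 / k) * ln L + e.
Proof.
move=> L0 hL e e0; set h := k / 2 * e.
have h0 : 0 < h by apply: mulr_gt0 => //; apply: divr_gt0.
pose d := L * Num.min (expR h - 1) (1 - expR (- h)).
have d0 : 0 < d.
  by rewrite mulr_gt0 // lt_min !subr_gt0 expR_gt1 expR_lt1 h0 oppr_lt0 h0.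
have [r r0 hr] := hL d d0; exists r => // y /hr /andP[y1 y2].
have vE : v y = - (2 / k) * ln (conf_pow v k y).
  by rewrite /conf_pow expRK; field; rewrite gt_eqF.
have P0 : 0 < conf_pow v k y by exact: expR_gt0.
have lo : L * expR (- h) <= conf_pow v k y.
  apply: le_trans y1; rewrite -[X in X - _]mulr1 -mulrBr ler_pM2l //.
  by rewrite lerBrDl -lerBrDr ge_min lexx orbT.
have hi : conf_pow v k y <= L * expR h.
  apply: le_trans y2 _; rewrite -[X in X + _]mulr1 -mulrDr ler_pM2l //.
  by rewrite -lerBrDl ge_min lexx.
have {}lo : ln L - h <= ln (conf_pow v k y).
  by rewrite -[- h]expRK -lnM ?posrE ?expR_gt0 // ler_ln ?posrE // mulr_gt0 ?expR_gt0.
have {}hi : ln (conf_pow v k y) <= ln L + h.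
  by rewrite -[h]expRK -lnM ?posrE ?expR_gt0 // ler_ln ?posrE // mulr_gt0 ?expR_gt0.
have eE : e = 2 / k * h by rewrite /h; field; rewrite gt_eqF.
have c0 : 0 < 2 / k by rewrite divr_gt0.
rewrite vE {1 2}eE; apply/andP; split.
  by rewrite !mulNr -opprD -mulrDr lerN2 ler_pM2l.
by rewrite !mulNr lerNl opprD opprK -mulrBr ler_pM2l.
Qed.


Let kn0 : k != 0. Proof. by rewrite gt_eqF. Qed.

(** The profile with A and B slightly larger than the limits at infinity and at 0
    lies below [u] near both ends; its exponent is below (p-1)/2. *)
Lemma conf_pow_affine_le L0 L1 : 0 <= L0 -> 0 <= L1 ->
  (forall e, 0 < e -> exists2 r, 0 < r & forall y, 0 < norm2 y <= r ->
     conf_pow u k y <= L0 + e) ->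
  (forall e, 0 < e -> exists2 r, 0 < r & forall y, 0 < norm2 y <= r ->
     conf_pow (kelvin_transform u) k y <= L1 + e) ->
  forall y, y != 0 -> conf_pow u k y <= L1 * norm2 y `^ k + L0.
Proof.
move=> L00 L10 h0 h1 y y0; have z0 : 0 <= norm2 y `^ k by exact: powR_ge0.
suff S e : 0 < e -> conf_pow u k y <= (L1 + e) * norm2 y `^ k + (L0 + e).
  apply/ler_addgt0Pr => e e0; have d0 : 0 < norm2 y `^ k + 1 by lra.
  have := S _ (divr_gt0 e0 d0); set d := e / _.
  have : d * (norm2 y `^ k + 1) = e by rewrite /d divfK // gt_eqF.
  lra.
move=> e0; have A0 : 0 < L1 + e by lra. have B0 : 0 < L0 + e by lra.
have [r r0 hr] := h0 e e0; have [q q0 hq] := h1 e e0.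
have W z : 0 < weight k (L1 + e) (L0 + e) z by apply: weight_gt0 => //; exact: ltW.
rewrite (conf_pow_le_weight u y k0 (W _)).
apply: (@super_squeeze k _ _ 0 r q^-1) => //.
- by rewrite /k; case/andP: hp; lra.
- move=> w wr; rewrite -conf_pow_le_weight //; apply: le_trans (hr w wr) _.
  by rewrite /weight lerDr mulr_ge0 ?powR_ge0 // ltW.
- move=> w w0 wq; rewrite -conf_pow_le_weight // conf_pow_kelvin //.
  have n0 : 0 < norm2 w by rewrite norm2_gt0.
  apply: le_trans (_ : (L1 + e) * norm2 w `^ k <= _); last by rewrite lerDl ltW.
  rewrite ler_pM2r ?powR_gt0 //; apply: hq; rewrite norm2_kelvin // invr_gt0 n0 /=.
  by rewrite -[leRHS]invrK lef_pV2 // posrE invr_gt0.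
Qed.

Section TwoFiniteLimits.
Variables a0 a1 : R.
Hypothesis lim0 : forall e, 0 < e -> exists2 r, 0 < r & forall y, 0 < norm2 y <= r ->
  a0 - e <= u y <= a0 + e.
Hypothesis lim1 : forall e, 0 < e -> exists2 r, 0 < r & forall y, 0 < norm2 y <= r ->
  a1 - e <= kelvin_transform u y <= a1 + e.
Let A (t : R) := expR (- (t / 2) * a1).
Let B (t : R) := expR (- (t / 2) * a0).

Lemma lim1_infty e : 0 < e -> exists2 r, 0 < r & forall y, y != 0 -> r <= norm2 y ->
  a1 - e <= u y + 2 * ln (norm2 y) <= a1 + e.
Proof.
move=> /lim1[r r0 hr]; exists r^-1 => [|y y0 yr]; first by rewrite invr_gt0.
rewrite -kelvin_transformE //; apply: hr; rewrite norm2_kelvin // invr_gt0 norm2_gt0 y0 /=.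
by rewrite -[leRHS]invrK lef_pV2 // posrE ?invr_gt0 ?norm2_gt0.
Qed.

Let lnA t : 0 < t -> - (2 / t) * ln (A t) = a1.
Proof. by move=> t0; rewrite /A expRK; field; rewrite gt_eqF. Qed.
Let lnB t : 0 < t -> - (2 / t) * ln (B t) = a0.
Proof. by move=> t0; rewrite /B expRK; field; rewrite gt_eqF. Qed.

(** The profile of exponent [t] having exactly the limits [a0] and [a1]
    approaches them from below, so that after lowering it by [e] it lies below [u]
    near both ends. *)
Lemma conf_pow_le_interp t y : 0 < t -> 2 * t < p - 1 -> y != 0 ->
  conf_pow u t y <=
    expR (- (t / 2) * a1) * norm2 y `^ t + expR (- (t / 2) * a0).
Proof.
move=> t0 tp y0; rewrite -/(A t) -/(B t) -/(weight t (A t) (B t) (norm2 y)).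
have A0 : 0 < A t by exact: expR_gt0.
have B0 : 0 < B t by exact: expR_gt0.
have c0 : 0 < 2 / t by exact: divr_gt0.
have W z : 0 < weight t (A t) (B t) z by apply: weight_gt0 => //; exact: ltW.
rewrite (conf_pow_le_weight u y t0 (W _)) -[leRHS]addr0; apply/ler_addgt0Pr => e e0.
have [r r0 hr] := lim0 e0; have [q q0 hq] := lim1_infty e0.
rewrite addr0 -lerBlDr profileD sub0r.
apply: (@super_squeeze t (A t) (B t) (- e) r q) => //.
  move=> w /[dup] /andP[w0 _] /hr /andP[+ _]; apply: le_trans.
  rewrite /profile -(lnB t0) mulNr addrC lerD2r lerN2 ler_pM2l // ler_ln ?posrE //.
  by rewrite /weight lerDr mulr_ge0 ?powR_ge0 // ltW.
move=> w w0 /(hq w w0) /andP[+ _]; rewrite -lerBlDr; apply: le_trans.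
have n0 : 0 < norm2 w by rewrite norm2_gt0.
have -> : a1 - e - 2 * ln (norm2 w) = - e - 2 / t * ln (A t * norm2 w `^ t).
  rewrite lnM ?posrE ?powR_gt0 // ln_powR -(lnA t0); field; by rewrite gt_eqF.
rewrite /profile lerD2l lerN2 ler_pM2l // ler_ln ?posrE ?mulr_gt0 ?powR_gt0 //.
by rewrite /weight lerDl ltW.
Qed.

(** Here the profile must lie above [u] near the ends although it approaches its
    limits from below; hence the two smallness thresholds, on A z^t compared with
    B near 0, and on B compared with A z^t near infinity. *)
Lemma interp_le_conf_pow t y : 0 < t -> p - 1 < 2 * t -> y != 0 ->
  expR (- (t / 2) * a1) * norm2 y `^ t + expR (- (t / 2) * a0) <=
    conf_pow u t y.
Proof.
move=> t0 tp y0; rewrite -/(A t) -/(B t) -/(weight t (A t) (B t) (norm2 y)).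
have A0 : 0 < A t by exact: expR_gt0.
have B0 : 0 < B t by exact: expR_gt0.
have c0 : 0 < 2 / t by exact: divr_gt0.
have W z : 0 < weight t (A t) (B t) z by apply: weight_gt0 => //; exact: ltW.
suff : u y <= profile t (A t) (B t) 0 (norm2 y).
  rewrite /profile sub0r lerNr => h; rewrite -[leLHS]lnK ?posrE // ler_expR.
  by rewrite mulNr lerNr -ler_pdivlMl ?divr_gt0 // invf_div mulrN lerNr.
apply/ler_addgt0Pr => e2 e20; pose e := e2 / 2; have e0 : 0 < e by rewrite divr_gt0.
have [r r0 hr] := lim0 e0; have [q q0 hq] := lim1_infty e0.
pose h := expR (t / 2 * e) - 1.
have h0 : 0 < h by rewrite subr_gt0 expR_gt1 mulr_gt0 // divr_gt0.
have lnh : 2 / t * ln (1 + h) = e.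
  by rewrite /h addrC subrK expRK; field; rewrite gt_eqF.
(* Below [r'] one has A z^t <= h B, above [q'] one has B <= h A z^t. *)
pose r' := (B t * h / A t) `^ t^-1; pose q' := (B t / (A t * h)) `^ t^-1.
have r'0 : 0 < r' by rewrite powR_gt0 // divr_gt0 // mulr_gt0.
have q'0 : 0 < q' by rewrite powR_gt0 // divr_gt0 // mulr_gt0.
have tn0 : t != 0 by rewrite gt_eqF.
rewrite profileD add0r.
apply: (@sub_squeeze t (A t) (B t) e2 (Num.min r r') (Num.max q q')) => //.
- by rewrite lt_min r0.
- move=> w /andP[w0]; rewrite le_min => /andP[wr wr'].
  have /andP[_ ue] : a0 - e <= u w <= a0 + e by apply: hr; rewrite w0.
  apply: le_trans ue _.
  have : weight t (A t) (B t) (norm2 w) <= B t * (1 + h).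
    rewrite /weight mulrDr mulr1 addrC lerD2l mulrC -ler_pdivlMr //.
    rewrite -[leRHS](powRK tn0); last by rewrite ltW // divr_gt0 // mulr_gt0.
    by apply: ler_powR_base => //; exact: ltW.
  move=> hh; have {}hh : ln (weight t (A t) (B t) (norm2 w)) <= ln (B t * (1 + h)).
    by rewrite ler_ln ?posrE // mulr_gt0 // addr_gt0.
  have h1 : 0 < 1 + h by exact: addr_gt0.
  move: (ler_wpM2l (ltW c0) hh); rewrite lnM ?posrE // mulrDr lnh.
  by have := lnB t0; rewrite /profile /e; lra.
- move=> w w0; have n0 : 0 < norm2 w by rewrite norm2_gt0.
  rewrite ge_max => /andP[wq wq'].
  have /andP[_ ue] := hq w w0 wq.
  have : weight t (A t) (B t) (norm2 w) <= A t * norm2 w `^ t * (1 + h).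
    rewrite /weight mulrDr mulr1 lerD2l mulrAC mulrC -ler_pdivrMr ?mulr_gt0 //.
    rewrite -[leLHS](powRK tn0); last by rewrite ltW // divr_gt0 // mulr_gt0.
    by apply: ler_powR_base => //; exact: ltW.
  have P0 : 0 < norm2 w `^ t by exact: powR_gt0.
  move=> hh; have {}hh : ln (weight t (A t) (B t) (norm2 w)) <=
      ln (A t * norm2 w `^ t * (1 + h)).
    by rewrite ler_ln ?posrE // !mulr_gt0 // addr_gt0.
  have h1 : 0 < 1 + h by exact: addr_gt0.
  move: (ler_wpM2l (ltW c0) hh).
  rewrite lnM ?posrE // ?mulr_gt0 // lnM ?posrE // ln_powR 2!mulrDr lnh.
  have : 2 / t * (t * ln (norm2 w)) = 2 * ln (norm2 w) by field.
  by have := lnA t0; move: ue; rewrite /profile /e; lra.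
Qed.

End TwoFiniteLimits.
End TwoEnds.

(** * Classification of the solutions *)

Section Classification.
Variable R : realType.
Local Notation plane := 'rV[R]_2.
Implicit Types (x y : plane).

Lemma eq0_of_opposite_sides (d : R -> R) (b : R) : 0 < b -> {for b, continuous d} ->
  (forall t, 0 < t -> t < b -> d t <= 0) -> (forall t, b < t -> 0 <= d t) -> d b = 0.
Proof.
move=> b0 db lo hi; apply: le_anti; apply/andP; split; rewrite leNgt; apply/negP => h.
  have /nbhs_ballP[e /= e0 he] : \forall t \near b, 0 < d t by exact: (cvgr_gt _ db).
  pose m := Num.min e b / 2; have m0 : 0 < m by rewrite divr_gt0 // lt_min e0.
  have he' : Num.min e b <= e by rewrite ge_min lexx.
  have hb' : Num.min e b <= b by rewrite ge_min lexx orbT.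
  have me : m < e by rewrite /m; lra.
  have mb : m < b by rewrite /m; lra.
  have := he (b - m); rewrite -ball_normE /= opprB addrC subrK gtr0_norm // => /(_ me).
  by rewrite ltNge lo //; lra.
have /nbhs_ballP[e /= e0 he] : \forall t \near b, d t < 0 by exact: (cvgr_lt _ db).
have e2 : e / 2 < e by lra.
have := he (b + e / 2); rewrite -ball_normE /= opprD addrA subrr sub0r normrN gtr0_norm.
  by move=> /(_ e2); rewrite ltNge hi // ltrDl divr_gt0.
by rewrite divr_gt0.
Qed.

Variables (p : R) (u : plane -> R).
Hypothesis hp : 1 < p <= 2.
Hypothesis cu : forall x, x != 0 -> {for x, continuous u}.
Hypothesis Usup : radial_super p u.
Hypothesis Usub : radial_sub p u.
Hypothesis Uker : radial_super p (kelvin_transform u).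

Let k := (p - 1) / 4.
Let k0 : 0 < k. Proof. by rewrite /k divr_gt0 // subr_gt0; case/andP: hp. Qed.
Let b := (p - 1) / 2.
Let b0 : 0 < b. Proof. by rewrite /b divr_gt0 // subr_gt0; case/andP: hp. Qed.

(** The two bounds hold for exponents on either side of (p-1)/2 and depend
    continuously on the exponent. *)
Lemma conf_pow_interp a0 a1 :
  (forall e, 0 < e -> exists2 r, 0 < r & forall y, 0 < norm2 y <= r ->
    a0 - e <= u y <= a0 + e) ->
  (forall e, 0 < e -> exists2 r, 0 < r & forall y, 0 < norm2 y <= r ->
    a1 - e <= kelvin_transform u y <= a1 + e) ->
  forall y, y != 0 ->
    conf_pow u b y = expR (- (b / 2) * a1) * norm2 y `^ b + expR (- (b / 2) * a0).
Proof.
move=> lim0 lim1 y y0; apply/eqP; rewrite -subr_eq0; apply/eqP.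
have n0 : norm2 y != 0 by rewrite gt_eqF // norm2_gt0.
pose d t := conf_pow u t y -
  (expR (- (t / 2) * a1) * norm2 y `^ t + expR (- (t / 2) * a0)).
have cE (c c' : R) : {for b, continuous (fun t => expR (c * t + c'))}.
  apply: continuous_comp; last exact: continuous_expR.
  apply: continuousD; last exact: cst_continuous.
  by apply: continuousM; [exact: cst_continuous|exact: cvg_id].
apply: (@eq0_of_opposite_sides d b b0).
- rewrite (_ : d = fun t => expR (- (u y / 2) * t + 0) -
    (expR ((ln (norm2 y) - a1 / 2) * t + 0) + expR (- (a0 / 2) * t + 0))).
    by apply: continuousB; [|apply: continuousD]; exact: cE.
  apply/funext => t; rewrite /d /conf_pow /powR (negbTE n0) -expRD.
  congr (expR _ - (expR _ + expR _)); by field.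
- move=> t t0 tb; rewrite subr_le0; apply: (conf_pow_le_interp cu Usup lim0 lim1) => //.
  by move: tb; rewrite /b; lra.
- move=> t tb; have t0 : 0 < t by exact: lt_trans tb.
  rewrite subr_ge0; apply: (interp_le_conf_pow hp cu Usub lim0 lim1) => //.
  by move: tb; rewrite /b; lra.
Qed.

Lemma conf_pow_inj t x y : 0 < t -> conf_pow u t x = conf_pow u t y -> u x = u y.
Proof.
move=> t0 /expR_inj /mulfI; apply.
by rewrite oppr_eq0 mulf_neq0 ?gt_eqF // divr_gt0.
Qed.

(** If both limits of w^k are positive this is [conf_pow_interp]. If the one at
    infinity vanishes, then w^k <= L0 by [conf_pow_affine_le], and equality holds
    throughout by the last clause of [conf_pow_limit]; if the one at 0 vanishes, the
    same applies to the Kelvin transform. *)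
Lemma conf_pow_classification : exists A B : R, [/\ 0 <= A, 0 <= B &
  forall y, y != 0 -> conf_pow u b y = A * norm2 y `^ b + B].
Proof.
have e_neq0 : (dirv 0 : plane) != 0.
  rewrite -norm2_gt0 /norm2 /dirv !mxE /=.
  by rewrite expr1n expr0n addr0 ltr01.
set y1 := (dirv 0 : plane) in e_neq0.
have cuk := kelvin_transform_continuous cu.
have [L0 [L00 lim0 const0]] := conf_pow_limit hp cu Usup.
have [L1 [L10 lim1 const1]] := conf_pow_limit hp cuk Uker.
rewrite -/k in lim0 const0 lim1 const1.
have aff : forall y, y != 0 -> conf_pow u k y <= L1 * norm2 y `^ k + L0.
  apply: (conf_pow_affine_le hp cu Usup L00 L10).
    by move=> e /lim0[r r0 hr]; exists r => // y /hr /andP[].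
  by move=> e /lim1[r r0 hr]; exists r => // y /hr /andP[].
have [L0E|L0n] := eqVneq L0 0; last first.
  have [L1E|L1n] := eqVneq L1 0.
    have uc : forall y, y != 0 -> conf_pow u k y = L0.
      by apply: const0 => y /aff; rewrite L1E mul0r add0r.
    exists 0, (conf_pow u b y1); split=> // [|y y0]; first exact: expR_ge0.
    rewrite mul0r add0r /conf_pow (@conf_pow_inj k y y1) //.
    by rewrite !uc.
  have L0p : 0 < L0 by rewrite lt_neqAle eq_sym L0n.
  have L1p : 0 < L1 by rewrite lt_neqAle eq_sym L1n.
  have E := conf_pow_interp (limit_of_conf_pow hp L0p lim0) (limit_of_conf_pow hp L1p lim1).
  exists (expR (- (b / 2) * (- (2 / k) * ln L1))), (expR (- (b / 2) * (- (2 / k) * ln L0))).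
  by split; [exact: expR_ge0|exact: expR_ge0|exact: E].
pose v := kelvin_transform u.
have vc y : y != 0 -> conf_pow v k y = L1.
  apply: const1 => {}y y0; have := aff _ (kelvin_neq0 y0).
  rewrite L0E addr0 conf_pow_kelvin ?kelvin_neq0 // kelvinK //.
  by rewrite ler_pM2r // powR_gt0 // norm2_gt0 kelvin_neq0.
exists (conf_pow v b y1), 0; split=> // [|y y0]; first exact: expR_ge0.
rewrite addr0 conf_pow_kelvin //; congr (_ * _).
have k2 : - (k / 2) != 0 by rewrite oppr_eq0 mulf_neq0 ?gt_eqF // divr_gt0.
have : v (kelvin y) = v y1.
  by apply: (mulfI k2); apply: expR_inj; exact: etrans (vc _ (kelvin_neq0 y0)) (esym (vc _ _)).
by rewrite /conf_pow -/v => ->.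
Qed.

Lemma solution_nonincreasing x y : x != 0 -> y != 0 -> norm2 x <= norm2 y -> u y <= u x.
Proof.
move=> x0 y0 xy; have [A [B [A0 B0 E]]] := conf_pow_classification.
rewrite -(ler_conf_pow u _ _ b0) !E // lerD2r ler_wpM2l //.
by apply: ler_powR_base; rewrite ?norm2_ge0 // ltW.
Qed.

(** Monotonicity of u + 4 ln |y|: the function A z^b + B grows at most like
    z^b. *)
Lemma solution_log_lipschitz x y : x != 0 -> y != 0 -> norm2 x <= norm2 y ->
  u x - u y <= 2 * ln (norm2 y / norm2 x).
Proof.
move=> x0 y0 xy; have [A [B [A0 B0 E]]] := conf_pow_classification.
have nx : 0 < norm2 x by rewrite norm2_gt0.
have ny : 0 < norm2 y by rewrite norm2_gt0.
have q0 : 0 < norm2 y / norm2 x by rewrite divr_gt0.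
have : conf_pow u b y <= (norm2 y / norm2 x) `^ b * conf_pow u b x.
  have qb : (norm2 y / norm2 x) `^ b * norm2 x `^ b = norm2 y `^ b.
    by rewrite -powRM ?(ltW q0) ?(ltW nx) // divfK // gt_eqF.
  rewrite !E // mulrDr mulrCA qb lerD2l.
  rewrite ler_peMl // -[leLHS](powRr0 (norm2 y / norm2 x)).
  by apply: ler_powR; [rewrite ler_pdivlMr // mul1r|exact: ltW].
rewrite {1}/powR gt_eqF // -expRD ler_expR => h.
have b2 : 0 < 2 / b by rewrite divr_gt0.
have := ler_wpM2l (ltW b2) h.
have -> : 2 / b * (- (b / 2) * u y) = - u y by field; rewrite gt_eqF.
have -> : 2 / b * (b * ln (norm2 y / norm2 x) + - (b / 2) * u x) =
  2 * ln (norm2 y / norm2 x) - u x by field; rewrite gt_eqF.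
by lra.
Qed.

Lemma coord_le_mx_norm y i : `|y ord0 i| <= `|y|.
Proof.
rewrite [leRHS]/Num.norm /= mx_normrE.
by apply/bigmax_geP; right => /=; exists (ord0, i).
Qed.

(** [u] decreases, by at most a multiple of ln |y|, and |y|^2 is locally
    Lipschitz. *)
Lemma solution_locally_lipschitz : locally_lipschitz_on (@punctured_plane R) u.
Proof.
move=> x0 x00; have n0 : 0 < norm2 x0 by rewrite norm2_gt0.
pose M := `|x0| + 1; have M0 : 0 < M by rewrite ltr_wpDl.
pose W := [set y | norm2 x0 / 2 < norm2 y /\ `|y| < M]; exists W.
  have h1 : \forall y \near x0, norm2 x0 / 2 < norm2 y.
    have cN := @norm2_continuous R x0; have lN : norm2 x0 / 2 < norm2 x0 by lra.
    exact: (cvgr_gt _ cN).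
  have h2 : \forall y \near x0, `|y| < M.
    have cM := @norm_continuous R plane x0; have lM : `|x0| < M by rewrite ltrDl.
    exact: (cvgr_lt _ cM).
  by near=> y; split; near: y.
have PF : ProperFilter (globally (W `*` W)).
  apply: (@globally_properfilter _ _ (x0, x0)).
  by have Wx0 : W x0 by [split; [lra|rewrite ltrDl]]; split.
apply: (@klipschitzW _ _ _ (16 * M / norm2 x0)) => -[x y] /= [[x1 x2] [y1 y2]].
have key x' y' : norm2 x0 / 2 < norm2 x' -> `|x'| < M -> `|y'| < M ->
    norm2 x' <= norm2 y' -> `|u x' - u y'| <= 16 * M / norm2 x0 * `|x' - y'|.
  move=> hx xM yM xy; have nx : 0 < norm2 x' by lra.
  have xn : x' != 0 by rewrite -norm2_gt0.
  have yn : y' != 0 by rewrite -norm2_gt0; lra.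
  rewrite ger0_norm ?subr_ge0; last exact: solution_nonincreasing.
  apply: le_trans (solution_log_lipschitz xn yn xy) _.
  have q0 : 0 < norm2 y' / norm2 x' by rewrite divr_gt0 //; lra.
  have : ln (norm2 y' / norm2 x') <= norm2 y' / norm2 x' - 1.
    by have := @le_ln1Dx R (norm2 y' / norm2 x' - 1); rewrite addrCA subrr addr0; apply; lra.
  have -> : norm2 y' / norm2 x' - 1 = (norm2 y' - norm2 x') / norm2 x'.
    by field; rewrite gt_eqF.
  move=> h; have hN : norm2 y' - norm2 x' <= 4 * M * `|x' - y'|.
    have c i : y' ord0 i ^+ 2 - x' ord0 i ^+ 2 <= 2 * M * `|x' - y'|.
      rewrite subr_sqr; apply: le_trans (ler_norm _) _; rewrite normrM mulrC.
      apply: ler_pM => //.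
        apply: le_trans (ler_normD _ _) _.
        by have := coord_le_mx_norm x' i; have := coord_le_mx_norm y' i; lra.
      rewrite distrC; have := coord_le_mx_norm (x' - y') i; by rewrite !mxE.
    by have := c 0; have := c 1; rewrite /norm2; lra.
  have h3 : (norm2 y' - norm2 x') / norm2 x' <= 8 * M / norm2 x0 * `|x' - y'|.
    rewrite ler_pdivrMr //; apply: le_trans hN _.
    have -> : 4 * M * `|x' - y'| = 8 * M / norm2 x0 * `|x' - y'| * (norm2 x0 / 2).
      by field; rewrite gt_eqF.
    rewrite ler_wpM2l ?(ltW hx) // mulr_ge0 // divr_ge0 ?ltW // mulr_gt0 //.
  have -> : 16 * M / norm2 x0 * `|x' - y'| = 2 * (8 * M / norm2 x0 * `|x' - y'|).
    by ring.
  by rewrite ler_pM2l //; exact: le_trans h h3.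
have [xy|/ltW xy] := leP (norm2 x) (norm2 y); first exact: key.
by rewrite distrC [`|x - y|]distrC; exact: key.
Unshelve. all: by end_near.
Qed.

End Classification.

Theorem theorem1p9 (R : realType) (p : R) (u : 'rV[R]_2 -> R)
    (hp : 1 < p <= 2)
    (ucont : forall x : 'rV[R]_2, punctured_plane x -> {for x, continuous u})
    (usol : viscosity_solution (Gamma p) punctured_plane (fun x => (u x)%:E)) :
  [/\ locally_lipschitz_on punctured_plane u,
      forall x y : 'rV[R]_2, punctured_plane x -> punctured_plane y ->
        enorm x = enorm y -> u x = u y &
      forall x y : 'rV[R]_2, punctured_plane x -> punctured_plane y ->
        enorm x <= enorm y -> u y <= u x].
Proof.
case: usol => usub usup.
have Usup := radial_super_viscosity usup.
have Usub := radial_sub_viscosity usub.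
have Uker := radial_super_kelvin usup.
have mono x y : punctured_plane x -> punctured_plane y -> enorm x <= enorm y -> u y <= u x.
  move=> x0 y0 xy; apply: (solution_nonincreasing hp ucont Usup Usub Uker) => //.
  by rewrite -!enorm_sq lerXn2r // nnegrE sqrtr_ge0.
split=> // [|x y x0 y0 xy].
  exact: (solution_locally_lipschitz hp ucont Usup Usub Uker).
by apply: le_anti; rewrite !mono ?xy.
Qed.
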